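(* Let $M=\{(x,y,z)\in\mathbb{C}^3: x^2+y^2+z^2=3xyz\}$ be the Markov surface with the holomorphic symplectic form $\omega=\frac{dx\wedge dy}{2z-3xy}$ on its regular part, and let $G$ be the group of holomorphic symplectic automorphisms of $M$. Then the set of ordered Markov triples $\{(x,y,z)\in\mathbb{N}^3 : x^2+y^2+z^2=3xyz,\ x\le y\le z\}$ is a $G$-tame subset of $M$.
   Context: $\mathbb{N}=\{1,2,3,\dots\}$. A holomorphic symplectic automorphism of $M$ is a holomorphic automorphism $F$ with $F^*\omega=\omega$ on $M_{\mathrm{reg}}$. For a group $G$ acting on a normal reduced complex space $X$ by holomorphic automorphisms, an infinite closed discrete subset $A\subset X_{\mathrm{reg}}$ is called $G$-tame if for every injective map $\imath\colon A\to A$ there exists $F\in G$ with $F|_A=\imath$. *)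

(* Defs.v *)
(* C is modelled as R[i] (= complex R)
   for an arbitrary realType R; C^3 is the row-vector space 'rV[R[i]]_3,
   normed (hence topologized) over the numFieldType R[i], so that
   [differentiable] below is complex (Frechet) differentiability. *)
From HB Require Import structures.
From mathcomp Require Import all_boot all_order all_algebra.
From mathcomp Require Import complex.
From mathcomp Require Import all_classical all_reals all_analysis.
Set Implicit Arguments. Unset Strict Implicit. Unset Printing Implicit Defensive.
Import Order.TTheory GRing.Theory Num.Theory.
Import numFieldNormedType.Exports.
Local Open Scope ring_scope.
Local Open Scope classical_set_scope.

Section Markov.
Variable R : realType.

Definition C3 : normedModType R[i] := 'rV[R[i]]_3.

Definition i0 : 'I_3 := @Ordinal 3 0 isT.
Definition i1 : 'I_3 := @Ordinal 3 1 isT.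
Definition i2 : 'I_3 := @Ordinal 3 2 isT.

Definition cx (v : C3) : R[i] := (v : 'rV[R[i]]_3) ord0 i0.
Definition cy (v : C3) : R[i] := (v : 'rV[R[i]]_3) ord0 i1.
Definition cz (v : C3) : R[i] := (v : 'rV[R[i]]_3) ord0 i2.

Definition pt (a b c : R[i]) : C3 :=
  \row_(j < 3) (if j == i0 then a else if j == i1 then b else c).

Definition markovP (v : C3) : R[i] :=
  cx v ^+ 2 + cy v ^+ 2 + cz v ^+ 2 - 3 * cx v * cy v * cz v.

Definition Px (v : C3) : R[i] := 2 * cx v - 3 * cy v * cz v.
Definition Py (v : C3) : R[i] := 2 * cy v - 3 * cx v * cz v.
Definition Pz (v : C3) : R[i] := 2 * cz v - 3 * cx v * cy v.

(* the Markov surface M and its regular part M_reg (P is reduced, so the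
   singular locus of M is where the gradient of P vanishes) *)
Definition M : set C3 := [set v | markovP v = 0].
Definition Mreg : set C3 :=
  [set v | M v /\ ~ (Px v = 0 /\ Py v = 0 /\ Pz v = 0)].

Definition tangent (p u : C3) : Prop :=
  Px p * cx u + Py p * cy u + Pz p * cz u = 0.

(* the holomorphic symplectic form omega = dx /\ dy / (2z - 3xy) on M_reg,
   evaluated on tangent vectors u, v at p.  Where 2z - 3xy = 0 we use the
   equal expressions dy /\ dz / (2x - 3yz) and dz /\ dx / (2y - 3xz)
   (the unique holomorphic extension of omega to M_reg). *)
Definition omega (p u v : C3) : R[i] :=
  if Pz p != 0 then (cx u * cy v - cy u * cx v) / Pz p
  else if Px p != 0 then (cy u * cz v - cz u * cy v) / Px p
  else (cz u * cx v - cx u * cz v) / Py p.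

Definition hol_ext_at (F G : C3 -> C3) (p : C3) : Prop :=
  exists U : set C3, [/\ open U, U p,
    (forall q, U q -> differentiable G q) &
    (forall q, U q -> M q -> G q = F q)].

(* F is a holomorphic map M -> M (locally the restriction of a holomorphic
   map defined on an open subset of C^3; M is normal, so this is the notion
   of holomorphic map of the complex space M) *)
Definition hol_map_M (F : C3 -> C3) : Prop :=
  (forall p, M p -> M (F p)) /\
  (forall p, M p -> exists G, hol_ext_at F G p).

Definition hol_aut_M (F : C3 -> C3) : Prop :=
  hol_map_M F /\
  exists Finv : C3 -> C3, [/\ hol_map_M Finv,
    (forall p, M p -> Finv (F p) = p) &
    (forall p, M p -> F (Finv p) = p)].

(* F^* omega = omega on M_reg (the differential of F at p is computed
   through any local holomorphic extension G of F near p) *)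
Definition symplectic_M (F : C3 -> C3) : Prop :=
  forall p, Mreg p -> forall G, hol_ext_at F G p ->
    forall u v, tangent p u -> tangent p v ->
      omega (F p) ('d G p u) ('d G p v) = omega p u v.

Definition symp_aut (F : C3 -> C3) : Prop := hol_aut_M F /\ symplectic_M F.

(* A is closed and discrete in C^3 (equivalently in M, as M is closed) *)
Definition closed_discrete (A : set C3) : Prop :=
  closed A /\
  forall a, A a -> exists U : set C3, [/\ open U, U a &
    forall b, U b -> A b -> b = a].

Definition tame (Grp : (C3 -> C3) -> Prop) (A : set C3) : Prop :=
  [/\ A `<=` Mreg, infinite_set A, closed_discrete A &
   forall iota : C3 -> C3,
     (forall a, A a -> A (iota a)) ->
     (forall a b, A a -> A b -> iota a = iota b -> a = b) ->
     exists F, Grp F /\ forall a, A a -> F a = iota a].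

Definition markov_triples : set C3 :=
  [set v | exists x y z : nat,
     [/\ [&& (0 < x)%N, (0 < y)%N & (0 < z)%N],
         (x ^ 2 + y ^ 2 + z ^ 2 = 3 * x * y * z)%N,
         ((x <= y) && (y <= z))%N &
         v = pt x%:R y%:R z%:R]].

End Markov.

(* Main.v *)
Require Import Defs.
From HB Require Import structures.
From mathcomp Require Import all_boot all_order all_algebra complex.
From mathcomp Require Import all_classical all_reals all_analysis.
From mathcomp Require Import ring lra zify.
Set Implicit Arguments. Unset Strict Implicit. Unset Printing Implicit Defensive.
Import Order.TTheory GRing.Theory Num.Theory.
Import numFieldNormedType.Exports.
Import Normc.
Local Open Scope ring_scope.
Local Open Scope classical_set_scope.
Local Open Scope complex_scope.
Local Notation Re := complex.Re.
Local Notation Im := complex.Im.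
Local Notation Cn R := (complex_complex__canonical__Num_NumField R).

(** On C^3 consider holomorphic automorphisms of Jacobian determinant 1 that
    preserve the Markov polynomial P; since omega (u, v) = c means that the
    cross product of u and v is c grad P, they restrict to symplectic
    automorphisms of M.  The flow of the Hamiltonian x acts on (y, z) linearly
    by exp (t B), where B ^ 2 = 9 x ^ 2 - 4; letting the time t be an entire
    function of x gives the shears used below, and likewise for y and z.

    An entire function can be prescribed on a discrete set, so a z-shear Psi
    sends the ordered Markov triples to positive real points with distinct,
    discrete x-coordinates (each z occurs finitely often), and another one Psi'
    does the same for the y-coordinates.  Two positive real points of M with
    equal x are joined by the flow of x for some real time.  Given an injection
    iota, pick c_a on M with the x-coordinate of Psi (a) and the y-coordinate of
    Psi' (iota a): an x-shear moves all Psi (a) to c_a, a y-shear moves all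
    Psi' (iota a) to c_a, and F is Psi, then the x-shear, then the inverses of
    the y-shear and of Psi'. *)

(** * Absolutely convergent complex series *)

Section ComplexSeries.
Variable R : realType.
Implicit Types (u v : nat -> R[i]) (z w c : R[i]) (M : R).

Lemma normcE z : `|z| = (normc z)%:C.
Proof. by []. Qed.

Lemma normc_ge0 z : 0 <= normc z.
Proof. by case: z => a b /=; exact: sqrtr_ge0. Qed.

Lemma ler_normcD z w : normc (z + w) <= normc z + normc w.
Proof. exact: le_normcD. Qed.

Lemma normc_opp z : normc (- z) = normc z.
Proof. exact: normcN. Qed.

Lemma normcX z n : normc (z ^+ n) = normc z ^+ n.
Proof. by elim: n => [|n IH]; rewrite ?expr0 ?normc1 // !exprS normcM IH. Qed.

Lemma normc_real (x : R) : normc x%:C = `|x|.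
Proof. by rewrite /= expr0n /= addr0 sqrtr_sqr. Qed.

Lemma normc_nat n : normc (n%:R : R[i]) = n%:R.
Proof. by rewrite -(rmorph_nat (real_complex R)) normc_real normr_nat. Qed.

Lemma ler_Re_normc z : `|Re z| <= normc z.
Proof. by rewrite -lecR -normcE; exact: normc_ge_Re. Qed.

Lemma ler_Im_normc z : `|Im z| <= normc z.
Proof.
case: z => a b /=; rewrite -sqrtr_sqr ler_sqrt ?addr_ge0 ?sqr_ge0 //.
by rewrite lerDr sqr_ge0.
Qed.

Lemma ler_normc_ReIm z : normc z <= `|Re z| + `|Im z|.
Proof.
case: z => a b /=; rewrite -(ler_pXn2r (n := 2)) ?nnegrE ?sqrtr_ge0 //.
  by rewrite sqr_sqrtr ?addr_ge0 ?sqr_ge0 // sqrrD !real_normK ?num_real //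
     -addrA lerD2l lerDr mulrn_wge0 // mulr_ge0.
Qed.

Lemma ReD z w : Re (z + w) = Re z + Re w.
Proof. by case: z w => ? ? []. Qed.

Lemma ImD z w : Im (z + w) = Im z + Im w.
Proof. by case: z w => ? ? []. Qed.

Lemma ReM z w : Re (z * w) = Re z * Re w - Im z * Im w.
Proof. by case: z w => ? ? []. Qed.

Lemma ImM z w : Im (z * w) = Re z * Im w + Im z * Re w.
Proof. by case: z w => ? ? []. Qed.

(* Absolutely convergent series only: otherwise the limits below are junk. *)
Definition csum u : R[i] :=
  limn (series (fun k => Re (u k))) +i* limn (series (fun k => Im (u k))).

(** One fixed geometric rate serves all series below: it gives absolute convergence of both parts
    and survives sums and scalar multiples, with only [M] changing. *)
Definition geom_dominated M u := forall k, normc (u k) <= M / 2 ^+ k.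

Lemma geom_dominated_ge0 M u : geom_dominated M u -> 0 <= M.
Proof.
by move=> /(_ 0%N); rewrite expr0 divr1; apply: le_trans; exact: normc_ge0.
Qed.

Lemma geom_lim M : series (fun k => M / 2 ^+ k) @ \oo --> M * 2.
Proof.
have -> : (fun k => M / 2 ^+ k) = geometric M 2^-1.
  by apply/funext => k /=; rewrite exprVn.
have := @cvg_geometric_series R M 2^-1.
rewrite (_ : (1 - 2^-1)^-1 = 2); last by field.
by apply; rewrite ger0_norm ?invr_ge0 // invf_lt1 // ltr1n.
Qed.

Lemma geom_real_cvg M (f : nat -> R) : (forall k, `|f k| <= M / 2 ^+ k) ->
  cvgn (series f) /\ `|limn (series f)| <= M * 2.
Proof.
move=> H.
have cg : cvgn (series (fun k => M / 2 ^+ k)) by apply/cvg_ex; exists (M * 2); exact: geom_lim.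
have cn : cvgn [normed series f].
  apply: series_le_cvg cg => // k; first exact: normr_ge0.
  exact: le_trans (H k).
split; first exact: normed_cvg.
apply: (le_trans (lim_series_norm cn)).
by rewrite -(cvg_lim (@Rhausdorff R) (@geom_lim M)); exact: lim_series_le.
Qed.

Lemma geom_Re M u : geom_dominated M u -> forall k, `|Re (u k)| <= M / 2 ^+ k.
Proof. by move=> H k; apply: le_trans (H k); exact: ler_Re_normc. Qed.

Lemma geom_Im M u : geom_dominated M u -> forall k, `|Im (u k)| <= M / 2 ^+ k.
Proof. by move=> H k; apply: le_trans (H k); exact: ler_Im_normc. Qed.

(** The majorant sums to [2 * M]; bounding real and imaginary parts separately doubles this. *)
Lemma normc_csum M u : geom_dominated M u -> normc (csum u) <= 4 * M.
Proof.
move=> H; apply: le_trans (ler_normc_ReIm _) _ => /=.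
have [_ h1] := geom_real_cvg (geom_Re H); have [_ h2] := geom_real_cvg (geom_Im H).
by lra.
Qed.

Lemma csumD M N u v : geom_dominated M u -> geom_dominated N v ->
  csum (fun k => u k + v k) = csum u + csum v.
Proof.
move=> Hu Hv; rewrite /csum.
have [ru _] := geom_real_cvg (geom_Re Hu); have [iu _] := geom_real_cvg (geom_Im Hu).
have [rv _] := geom_real_cvg (geom_Re Hv); have [iv _] := geom_real_cvg (geom_Im Hv).
simpc; congr (_ +i* _); rewrite -lim_seriesD //; congr (limn (series _));
  by apply/funext => k; rewrite ?ReD ?ImD.
Qed.

Lemma csumZ M c u : geom_dominated M u ->
  csum (fun k => c * u k) = c * csum u.
Proof.
move=> Hu; rewrite /csum.
have [ru _] := geom_real_cvg (geom_Re Hu); have [iu _] := geom_real_cvg (geom_Im Hu).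
have -> (x y : R) : c * (x +i* y) = (Re c * x - Im c * y) +i* (Re c * y + Im c * x).
  by case: (c).
congr (_ +i* _).
- rewrite -[Re c * _](lim_seriesZ (Re c) ru) -[Im c * _](lim_seriesZ (Im c) iu) -lim_seriesB; try exact: is_cvg_seriesZ.
  by congr (limn (series _)); apply/funext => k; rewrite ?ReM ?ImM.
- rewrite -[Re c * _](lim_seriesZ (Re c) iu) -[Im c * _](lim_seriesZ (Im c) ru) -lim_seriesD; try exact: is_cvg_seriesZ.
  by congr (limn (series _)); apply/funext => k; rewrite ?ReM ?ImM.
Qed.

Lemma geom_dominatedD M N u v : geom_dominated M u -> geom_dominated N v ->
  geom_dominated (M + N) (fun k => u k + v k).
Proof.
by move=> Hu Hv k; apply: le_trans (ler_normcD _ _) _; rewrite mulrDl lerD.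
Qed.

Lemma geom_dominatedZ M c u : geom_dominated M u ->
  geom_dominated (normc c * M) (fun k => c * u k).
Proof.
by move=> Hu k; rewrite normcM -mulrA ler_wpM2l ?normc_ge0.
Qed.

Lemma csumB M N u v : geom_dominated M u -> geom_dominated N v ->
  csum (fun k => u k - v k) = csum u - csum v.
Proof.
move=> Hu Hv; rewrite -[- csum v]mulN1r -(csumZ _ Hv).
rewrite -(csumD Hu (geom_dominatedZ (-1) Hv)).
by congr csum; apply/funext => k; rewrite mulN1r.
Qed.

Lemma csum_fin n u : (forall k, (n <= k)%N -> u k = 0) -> csum u = \sum_(k < n) u k.
Proof.
move=> H.
have E (f : nat -> R) : (forall k, (n <= k)%N -> f k = 0) ->
    limn (series f) = \sum_(k < n) f k.
  move=> Hf; apply: (@lim_near_cst R^o); first exact: Rhausdorff.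
  exists n => // m /= nm; rewrite /series /= (big_cat_nat (leq0n n) nm) /= big_mkord.
  rewrite [X in _ + X]big_nat_cond [X in _ + X]big1 ?addr0 // => i.
  by rewrite andbT => /andP[ni _]; rewrite Hf.
rewrite /csum !E; try by move=> k /H ->.
rewrite [RHS](_ : _ = (\sum_(k < n) Re (u k)) +i* (\sum_(k < n) Im (u k))) //.
elim: n {H E} => [|n IH]; first by rewrite !big_ord0.
by rewrite !big_ord_recr /= IH; case: (u n).
Qed.

Lemma csum_recl M u : geom_dominated M u -> csum u = u 0%N + csum (fun k => u k.+1).
Proof.
move=> Hu.
(* [v] carries the first term alone; once it is subtracted, the series starts with 0 and dropping
   that term only shifts the partial sums. *)
pose v k := if k is 0 then u 0%N else 0.
have Hv : geom_dominated (normc (u 0%N)) v.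
  case=> [|k] /=; first by rewrite expr0 divr1.
  by rewrite expr0n /= addr0 sqrtr0 divr_ge0 ?normc_ge0 // exprn_ge0.
rewrite -[LHS](subrK (csum v)) -(csumB Hu Hv) addrC; congr (_ + _).
  by rewrite (@csum_fin 1) ?big_ord1 // => -[].
have E (f : nat -> R) : cvgn (series f) -> f 0%N = 0 ->
    limn (series f) = limn (series (fun k => f k.+1)).
  move=> cf f0; apply/esym.
  have -> : series (fun k => f k.+1) = [sequence series f n.+1]_n.
    by apply/funext => n; rewrite /series /= big_nat_recl // f0 add0r.
  by apply: (cvg_lim (@Rhausdorff R)); rewrite (cvg_shiftS (series f)).
have Hw : geom_dominated (M + normc (-1 : R[i]) * normc (u 0%N)) (fun k => u k - v k).
  move=> k; have := geom_dominatedD Hu (geom_dominatedZ (-1) Hv) k.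
  by rewrite mulN1r.
have [rw _] := geom_real_cvg (geom_Re Hw); have [iw _] := geom_real_cvg (geom_Im Hw).
rewrite /csum (E _ rw) ?(E _ iw) ?subrr //=.
by congr (limn (series _) +i* limn (series _)); apply/funext => k; rewrite subr0.
Qed.

End ComplexSeries.

(** * Entire functions as series of polynomials *)

Section Entire.
Variable R : realType.
Implicit Types (z w h : R[i]) (p : {poly R[i]}) (r : R).

Lemma normc_sum n (F : 'I_n -> R[i]) : normc (\sum_i F i) <= \sum_i normc (F i).
Proof.
elim/big_ind2 : _ => //; first by rewrite normc0.
by move=> a b c d ab cd; apply: le_trans (ler_normcD _ _) _; exact: lerD.
Qed.

(** Coefficientwise majorant of [p] on the disc of radius [r]. At radii [r + 1] and [r + 2] it also
    bounds, on that same disc, the derivative and (up to [normc h ^+ 2]) the first-order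
    remainder. *)
Definition pnorm r p : R := \sum_(i < size p) normc p`_i * r ^+ i.

Lemma pnorm_widen n r p : (size p <= n)%N ->
  pnorm r p = \sum_(i < n) normc p`_i * r ^+ i.
Proof.
move=> pn; rewrite /pnorm (big_ord_widen _ (fun i => normc p`_i * r ^+ i) pn).
rewrite big_mkcond /=; apply: eq_bigr => i _; case: ltnP => // si.
by rewrite nth_default // normc0 mul0r.
Qed.

Lemma pnorm_ge0 r p : 0 <= r -> 0 <= pnorm r p.
Proof. by move=> r0; apply: sumr_ge0 => i _; rewrite mulr_ge0 ?normc_ge0 ?exprn_ge0. Qed.

Lemma ler_pnorm r r' p : 0 <= r -> r <= r' -> pnorm r p <= pnorm r' p.
Proof.
move=> r0 rr'; apply: ler_sum => i _; rewrite ler_wpM2l ?normc_ge0 //.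
by apply: lerXn2r; rewrite // nnegrE // (le_trans r0).
Qed.

Lemma pnormZ r c p : pnorm r (c *: p) = normc c * pnorm r p.
Proof.
rewrite (@pnorm_widen (size p)) ?size_scale_leq // /pnorm big_distrr /=.
by apply: eq_bigr => i _; rewrite coefZ normcM mulrA.
Qed.

Lemma pnormXM r p : pnorm r ('X * p) = r * pnorm r p.
Proof.
rewrite (@pnorm_widen (size p).+1); last first.
  by rewrite mulrC; have [->|p0] := eqVneq p 0; rewrite ?mul0r ?size_poly0 ?size_mulX.
rewrite big_ord_recl coefXM /= expr0 expr0n /= addr0 sqrtr0 mul0r add0r.
rewrite /pnorm big_distrr /=; apply: eq_bigr => i _.
by rewrite coefXM /= exprS mulrCA.
Qed.

Lemma pnormXnM r p n : pnorm r ('X^n * p) = r ^+ n * pnorm r p.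
Proof.
elim: n => [|n IH]; first by rewrite !expr0 !mul1r.
by rewrite !exprS -mulrA pnormXM IH mulrA.
Qed.

Lemma pnormXn r n : pnorm r 'X^n = r ^+ n.
Proof.
rewrite -['X^n]mulr1 pnormXnM /pnorm size_poly1 big_ord1 coef1 /=.
by rewrite expr1n expr0n /= addr0 sqrtr1 expr0 !mulr1.
Qed.

Lemma horner_derivE p z :
  p^`().[z] = \sum_(i < size p) p`_i * (i%:R * z ^+ i.-1).
Proof.
rewrite -{1}(coefK p) poly_def raddf_sum horner_sum; apply: eq_bigr => i _ /=.
by rewrite derivZ derivXn hornerZ hornerMn hornerXn mulr_natl.
Qed.

(** Enlarging the radius by 1 absorbs the factor [n] of a derivative: in the induction, one copy of
    [(r + 1) ^+ n] pays for the new [r ^+ n]. *)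
Lemma natr_expr_le n r : 0 <= r -> n%:R * r ^+ n.-1 <= (r + 1) ^+ n.
Proof.
move=> r0; have h1 : 0 <= r + 1 by rewrite addr_ge0.
elim: n => [|n IH]; first by rewrite mul0r expr0.
have h2 : r ^+ n <= (r + 1) ^+ n by apply: lerXn2r; rewrite ?nnegrE // lerDl.
rewrite exprS mulrDl mul1r -natr1 mulrDl mul1r; apply: lerD => //=.
case: n IH {h2} => [|n] IH; first by rewrite mul0r mulr_ge0.
by rewrite exprS mulrCA; exact: ler_wpM2l.
Qed.

Lemma expr_rem_le n r z h : normc z <= r -> normc h <= 1 ->
  normc ((z + h) ^+ n - z ^+ n - h * (n%:R * z ^+ n.-1)) <= normc h ^+ 2 * (r + 2) ^+ n.
Proof.
move=> zr h1; have r0 : 0 <= r by apply: le_trans zr; exact: normc_ge0.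
elim: n => [|n IH].
  by rewrite !expr0 subrr mul0r mulr0 subr0 normc0 mulr1 exprn_ge0 ?normc_ge0.
(* The new remainder is [z + h] times the old one plus [h ^+ 2] times the derivative of [z ^+ n];
   the bounds [r + 1] and 1 of the two contributions add up to [r + 2]. *)
have -> : (z + h) ^+ n.+1 - z ^+ n.+1 - h * (n.+1%:R * z ^+ n.+1.-1) =
    (z + h) * ((z + h) ^+ n - z ^+ n - h * (n%:R * z ^+ n.-1)) +
    h ^+ 2 * (n%:R * z ^+ n.-1).
  case: n {IH} => [|n] /=; first by rewrite !expr1 !expr0; ring.
  by rewrite -!natr1 !exprS; ring.
apply: le_trans (ler_normcD _ _) _.
rewrite !normcM !normcX normc_nat [(r + 2) ^+ _]exprS.
have zh : normc (z + h) <= r + 1 by apply: le_trans (ler_normcD _ _) _; exact: lerD.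
have k1 : n%:R * normc z ^+ n.-1 <= (r + 2) ^+ n.
  apply: (@le_trans _ _ (n%:R * r ^+ n.-1)).
    by rewrite ler_wpM2l // lerXn2r // nnegrE // normc_ge0.
  apply: le_trans (natr_expr_le n r0) _.
  by rewrite lerXn2r // ?nnegrE ?addr_ge0 // lerD2l ler1n.
have k2 := ler_pM (normc_ge0 _) (normc_ge0 _) zh IH.
have k3 := ler_wpM2l (exprn_ge0 2 (normc_ge0 h)) k1.
have -> : normc h ^+ 2 * ((r + 2) * (r + 2) ^+ n) =
  (r + 1) * (normc h ^+ 2 * (r + 2) ^+ n) + normc h ^+ 2 * (r + 2) ^+ n by ring.
exact: lerD.
Qed.

Lemma ler_normc_horner p z r : normc z <= r -> normc p.[z] <= pnorm r p.
Proof.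
move=> zr; rewrite horner_coef; apply: le_trans (normc_sum _) _.
apply: ler_sum => i _; rewrite normcM normcX ler_wpM2l ?normc_ge0 //.
by rewrite lerXn2r // nnegrE ?normc_ge0 // (le_trans _ zr) ?normc_ge0.
Qed.

Lemma ler_normc_deriv p z r : normc z <= r -> normc p^`().[z] <= pnorm (r + 1) p.
Proof.
move=> zr; rewrite horner_derivE; apply: le_trans (normc_sum _) _.
have r0 : 0 <= r by apply: le_trans zr; exact: normc_ge0.
apply: ler_sum => i _; rewrite !normcM normcX normc_nat ler_wpM2l ?normc_ge0 //.
apply: le_trans (natr_expr_le i r0); rewrite ler_wpM2l //.
by rewrite lerXn2r // nnegrE ?normc_ge0.
Qed.

Lemma ler_normc_rem p z h r : normc z <= r -> normc h <= 1 ->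
  normc (p.[z + h] - p.[z] - h * p^`().[z]) <= normc h ^+ 2 * pnorm (r + 2) p.
Proof.
move=> zr h1; rewrite horner_derivE !horner_coef big_distrr /= -!sumrB.
apply: le_trans (normc_sum _) _; rewrite /pnorm big_distrr /=.
apply: ler_sum => i _.
have -> : p`_i * (z + h) ^+ i - p`_i * z ^+ i - h * (p`_i * (i%:R * z ^+ i.-1)) =
  p`_i * ((z + h) ^+ i - z ^+ i - h * (i%:R * z ^+ i.-1)) by ring.
rewrite normcM [leRHS]mulrCA ler_wpM2l ?normc_ge0 //.
exact: expr_rem_le.
Qed.

(** A positive element of [R[i]] is real, so estimates with real [eps] and [normc] suffice for
    complex differentiability. *)
Lemma is_diff_littleo (e : Cn R -> Cn R) (z : Cn R) (d : R[i]) :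
  (forall eps : R, 0 < eps -> exists2 delta : R, 0 < delta & forall h : R[i],
     normc h < delta -> normc (e (z + h) - e z - h * d) <= eps * normc h) ->
  is_diff z e (fun h : R[i] => h * d).
Proof.
move=> H; pose D (h : Cn R) : Cn R := h *: (d : Cn R).
have lin : linear D by move=> a u v; rewrite /D scalerDl scalerA.
pose Dm := GRing.isLinear.Build _ _ _ _ _ lin.
pose DL : {linear _ -> _} := HB.pack D Dm.
have cD : continuous DL by exact: scalel_continuous.
have oD : e \o shift z = cst (e z) + DL +o_ 0 id.
  apply/eqaddoP => eps eps0.
  have /complex_realP[eps' E] : eps \is Num.real by rewrite gtr0_real.
  have eps'0 : 0 < eps' by rewrite -ltcR -E.
  have [delta d0 hd] := H _ eps'0.
  apply/nbhs_ballP; exists delta%:C; first by rewrite /= ltcR.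
  move=> h; rewrite -ball_normE /= sub0r normrN => hh.
  have hd' : normc (e (z + h) - e z - h * d) <= eps' * normc h.
    by apply: hd; rewrite -ltcR.
  have -> : eps * `|id h| = (eps' * normc h)%:C by rewrite E rmorphM.
  have -> : (e \o shift z - (cst (e z) + DL)) h = e (z + h) - e z - h * d :> R[i].
    by rewrite [z + h]addrC -[RHS]addrA -opprD.
  rewrite -lecR in hd'; exact: hd'.
have U := diff_unique cD oD.
by split; [apply/diff_locallyP; rewrite U|exact: U].
Qed.

Lemma is_diff_quadratic (e : Cn R -> Cn R) (z : Cn R) (d : R[i]) (K : R) :
  (forall h : R[i], normc h <= 1 -> normc (e (z + h) - e z - h * d) <= K * normc h ^+ 2) ->
  is_diff z e (fun h : R[i] => h * d).
Proof.
move=> H; apply: is_diff_littleo => eps eps0.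
have K0 : 0 <= K.
  by have := H 1; rewrite normc1 lexx expr1n mulr1 => /(_ isT); apply: le_trans; exact: normc_ge0.
exists (Num.min 1 (eps / (K + 1))).
  by rewrite lt_min ltr01 divr_gt0 // ltr_wpDl.
move=> h; rewrite lt_min => /andP[h1]; rewrite ltr_pdivlMr ?ltr_wpDl // => h2.
apply: le_trans (H h (ltW h1)) _; rewrite expr2 mulrA ler_wpM2r ?normc_ge0 //.
apply: le_trans (ltW h2); rewrite mulrC ler_wpM2l ?normc_ge0 //.
by rewrite lerDl.
Qed.

Definition entire (e : R[i] -> R[i]) := forall z : Cn R, differentiable (e : Cn R -> Cn R) z.

Definition pseries_sum (q : nat -> {poly R[i]}) z := csum (fun k => (q k).[z]).

(** Since [M] may depend on [r], it can absorb any finite number of initial terms; on each disc only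
    the tail has to decay at the fixed rate. *)
Definition pseries_cvg (q : nat -> {poly R[i]}) :=
  forall r, 0 <= r -> exists M : R, forall k, pnorm r (q k) <= M / 2 ^+ k.

Lemma pseries_dominated q z : pseries_cvg q -> exists M : R, 
  geom_dominated M (fun k => (q k).[z]) /\ geom_dominated M (fun k => (q k)^`().[z]).
Proof.
move=> H; have [M HM] := H (normc z + 1) (addr_ge0 (normc_ge0 z) ler01).
exists M; split=> k; apply: le_trans (HM k).
  apply: le_trans (ler_normc_horner _ (lexx _)) _.
  by apply: ler_pnorm; rewrite ?normc_ge0 // lerDl.
exact: ler_normc_deriv.
Qed.

(** Each term has a remainder of at most [normc h ^+ 2] times a term of one geometric series, so the
    remainders add up to a quadratic bound for the sum. *)
Lemma is_diff_pseries q (z : Cn R) : pseries_cvg q ->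
  is_diff z (pseries_sum q : Cn R -> Cn R) (fun h : R[i] => h * csum (fun k => (q k)^`().[z])).
Proof.
move=> H; have [M HM] := H (normc z + 2) (addr_ge0 (normc_ge0 z) (ler0n _ 2)).
have [M0 [D0 D1]] := pseries_dominated z H.
apply: (@is_diff_quadratic _ _ _ (4 * M)) => h h1.
have [Mh [Dh _]] := pseries_dominated (z + h) H.
rewrite /pseries_sum -(csumB Dh D0) -(csumZ h D1).
have DB : geom_dominated (Mh + M0) (fun k => (q k).[z + h] - (q k).[z]).
  move=> k; apply: le_trans (ler_normcD _ _) _; rewrite normc_opp mulrDl.
  by apply: lerD; [exact: Dh|exact: D0].
rewrite -(csumB DB (geom_dominatedZ h D1)).
rewrite -mulrA.
apply: normc_csum => k; apply: le_trans (ler_normc_rem _ (lexx _) h1) _.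
rewrite [leRHS]mulrAC [leRHS]mulrC ler_wpM2l ?exprn_ge0 ?normc_ge0 //; exact: HM.
Qed.

Lemma entire_pseries q : pseries_cvg q -> entire (pseries_sum q).
Proof. by move=> H z; have D := is_diff_pseries z H. Qed.

End Entire.

(** * Interpolation by entire functions *)

Section Interpolation.
Variable R : realType.

(** A Newton correction damped by the [m]-th power of ['X / s k]: this factor is 1 at the new node
    and at most [2 ^- m] on the disc of radius [normc (s k) / 2], so a large [m] makes the
    correction small there. Hence the nodes must avoid 0. *)
Lemma newton_step (s : nat -> R[i]) (P : pred nat) (k : nat) (d : R[i]) :
  P k -> s k != 0 -> (forall j, (j < k)%N -> P j -> s j != s k) ->
  exists q : {poly R[i]}, [/\ forall j, (j < k)%N -> P j -> q.[s j] = 0,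
    q.[s k] = d & pnorm (normc (s k) / 2) q <= 1 / 2 ^+ k].
Proof.
move=> Pk s0 sj.
pose B : {poly R[i]} := \prod_(j < k | P j) ('X - (s j)%:P).
have Bj j : (j < k)%N -> P j -> B.[s j] = 0.
  move=> jk Pj; apply/eqP; rewrite -[_ == _]/(root B (s j)) /B.
  by rewrite (bigD1 (Ordinal jk)) //= rootM root_XsubC eqxx.
have Bk : B.[s k] != 0.
  rewrite /B horner_prod prodf_seq_neq0; apply/allP => j _ /=; apply/implyP => Pj.
  by rewrite hornerXsubC subr_eq0 eq_sym sj.
set r := normc (s k) / 2.
have r0 : 0 <= r by rewrite divr_ge0 ?normc_ge0.
pose K := normc (d / B.[s k]) * pnorm r B.
have K0 : 0 <= K by rewrite mulr_ge0 ?normc_ge0 ?pnorm_ge0.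
have [m Hm] : exists m, K * 2 ^+ k <= 2 ^+ m :> R.
  exists (Num.bound K + k)%N; rewrite exprD ler_wpM2r ?exprn_ge0 //; apply: ltW.
  apply: lt_le_trans (archi_boundP K0) _.
  by rewrite -natrX ler_nat ltnW // ltn_expl.
exists ((d / (s k ^+ m * B.[s k])) *: ('X^m * B)); split.
- by move=> j jk Pj; rewrite hornerZ hornerM (Bj j) ?mulr0.
- by rewrite hornerZ hornerM hornerXn divfK // mulf_neq0 // expf_neq0 //.
- rewrite pnormZ pnormXnM.
  have nsk : normc (s k) != 0 by apply: contra s0 => /eqP /eq0_normc ->.
  have nBk : normc B.[s k] != 0 by apply: contra Bk => /eqP /eq0_normc ->.
  have -> : normc (d / (s k ^+ m * B.[s k])) * (r ^+ m * pnorm r B) = K / 2 ^+ m.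
    rewrite /K /r !normcM !normcV !normcM normcX expr_div_n.
    have : normc (s k) ^+ m != 0 by rewrite expf_neq0.
    have : (2 : R) ^+ m != 0 by rewrite expf_neq0.
    move: (normc (s k) ^+ m) ((2 : R) ^+ m) => a b a0 b0.
    by field; rewrite nBk a0 b0.
  by rewrite ler_pdivrMr ?exprn_gt0 // mulrAC mul1r ler_pdivlMr ?exprn_gt0.
Qed.

Lemma interpolation_nat (s : nat -> R[i]) (P : pred nat) (t : nat -> R[i]) :
  (forall k, P k -> s k != 0) ->
  (forall j k, P j -> P k -> s j = s k -> j = k) ->
  (forall r : R, exists N, forall k, (N <= k)%N -> P k -> r <= normc (s k)) ->
  exists2 e, entire e & forall k, P k -> e (s k) = t k.
Proof.
move=> s0 sinj sinf.
have step (k : nat) (acc : {poly R[i]}) : {q : {poly R[i]} |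
    (P k -> [/\ forall j, (j < k)%N -> P j -> q.[s j] = 0,
    q.[s k] = t k - acc.[s k] & pnorm (normc (s k) / 2) q <= 1 / 2 ^+ k]) /\ (~~ P k -> q = 0)}.
  apply: cid; case: (boolP (P k)) => Pk; last by exists 0.
  have [||q Hq] := @newton_step s P k (t k - acc.[s k]) Pk; first exact: s0.
    by move=> j jk Pj; apply/eqP => /(sinj _ _ Pj Pk) jk'; rewrite jk' ltnn in jk.
  by exists q.
pose acc := fix acc k := if k is k'.+1 then acc k' + sval (step k' (acc k')) else 0.
pose q k := sval (step k (acc k)).
have accE k : acc k = \sum_(j < k) q j.
  by elim: k => [|k IH]; rewrite ?big_ord0 // big_ord_recr /= -IH.
have qP k : P k -> [/\ forall j, (j < k)%N -> P j -> (q k).[s j] = 0,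
    (q k).[s k] = t k - (acc k).[s k] & pnorm (normc (s k) / 2) (q k) <= 1 / 2 ^+ k].
  by have [] := svalP (step k (acc k)).
have q0 k : ~~ P k -> q k = 0.
  by have [] := svalP (step k (acc k)).
have cq : pseries_cvg q.
  (* From some [N] on, the nodes have modulus at least [r * 2], so the disc of radius [r] lies where
     the [k]-th correction is at most [2 ^- k]; the first [N] corrections are absorbed in [M]. *)
  move=> r r0; have [N HN] := sinf (r * 2).
  pose M := 1 + \sum_(j < N) pnorm r (q j) * 2 ^+ j.
  have M1 : 1 <= M.
    by rewrite lerDl sumr_ge0 // => j _; rewrite mulr_ge0 ?pnorm_ge0 ?exprn_ge0.
  exists M => k; rewrite ler_pdivlMr ?exprn_gt0 //.
  have [kN|Nk] := ltnP k N.
    rewrite /M (bigD1 (Ordinal kN)) //= addrCA lerDl addr_ge0 // sumr_ge0 // => j _.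
    by rewrite mulr_ge0 ?pnorm_ge0 ?exprn_ge0.
  apply: le_trans M1; have [Pk|Pk] := boolP (P k); last first.
    by rewrite q0 // /pnorm size_poly0 big_ord0 mul0r.
  rewrite -ler_pdivlMr ?exprn_gt0 //; have [_ _] := qP _ Pk; apply: le_trans.
  by apply: ler_pnorm => //; rewrite ler_pdivlMr // HN.
exists (pseries_sum q); first exact: entire_pseries.
(* At [s k] all later corrections vanish, and the [k]-th one completes the partial sum to [t k]. *)
move=> k Pk; rewrite /pseries_sum (@csum_fin _ k.+1).
  rewrite big_ord_recr /=; have [_ -> _] := qP _ Pk.
  by rewrite accE horner_sum addrC subrK.
move=> j kj; have [Pj|Pj] := boolP (P j); last by rewrite q0 // horner0.
by have [H _ _] := qP _ Pj; exact: H.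
Qed.

(** The list hypothesis puts finitely many nodes in each disc. The elements are enumerated by
    [pickle], and indices that code no element are excluded by the predicate. *)
Lemma interpolation (T : countType) (s : T -> R[i]) (P : pred T) (t : T -> R[i]) :
  (forall x, P x -> s x != 0) ->
  (forall x y, P x -> P y -> s x = s y -> x = y) ->
  (forall r : R, exists l : seq T, forall x, P x -> x \notin l -> r <= normc (s x)) ->
  exists2 e, entire e & forall x, P x -> e (s x) = t x.
Proof.
move=> s0 sinj sinf.
pose lift U (u0 : U) (f : T -> U) k := if pickle_inv k is Some x then f x else u0.
have [|||e ee He] := @interpolation_nat (lift _ 0 s) (lift _ false P) (lift _ 0 t).
- by move=> k; rewrite /lift; case: pickle_inv => // x; exact: s0.
- move=> j k; rewrite /lift.
  have := @pickle_invK T j; have := @pickle_invK T k.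
  case: pickle_inv => // x /= <-; case: pickle_inv => // y /= <- Px Py E.
  by rewrite (sinj _ _ Px Py E).
- move=> r; have [l Hl] := sinf r; exists (\max_(x <- l) (pickle x).+1)%N => k Nk.
  rewrite /lift; have := @pickle_invK T k; case: pickle_inv => // x /= xk Px.
  apply: Hl => //; apply/negP => xl; move: Nk; rewrite -xk leqNgt => /negP; apply.
  exact: (@leq_bigmax_seq _ l predT (fun x : T => (pickle x).+1) x xl isT).
exists e => // x Px.
by have := He (pickle x); rewrite /lift pickleK_inv; exact.
Qed.

End Interpolation.

(** * Hyperbolic functions of a square root *)

Section Toolkit.
Variables (K : numFieldType) (V : normedModType K).
Implicit Types (f g df dg : V -> K) (p : V).

(* The library's rules in pointwise form, so that they unify with lambdas. *)
Lemma is_diff_cstL (c : K) p : is_diff p (fun=> c) (fun=> 0 : K).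
Proof. exact: is_diff_cst. Qed.

Lemma is_diff_addL f g df dg p : is_diff p f df -> is_diff p g dg ->
  is_diff p (fun q => f q + g q) (fun u => df u + dg u).
Proof. exact: is_diffD. Qed.

Lemma is_diff_subL f g df dg p : is_diff p f df -> is_diff p g dg ->
  is_diff p (fun q => f q - g q) (fun u => df u - dg u).
Proof. exact: is_diffB. Qed.

Lemma is_diff_mulL f g df dg p : is_diff p f df -> is_diff p g dg ->
  is_diff p (fun q => f q * g q) (fun u => f p * dg u + g p * df u).
Proof. exact: is_diffM. Qed.

Lemma is_diff_compL (e : K -> K) (d : K) f df p : is_diff p f df ->
  is_diff (f p) e (fun h : K => h * d) -> is_diff p (fun q => e (f q)) (fun u => df u * d).
Proof. by move=> Hf He; apply: (is_diff_comp Hf He). Qed.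

End Toolkit.

Section HyperbolicFunctions.
Variable R : realType.
Implicit Types (z w : R[i]).

Definition coshq k : {poly R[i]} := ((2 * k)`!%:R)^-1 *: 'X^k.
Definition sinhq k : {poly R[i]} := ((2 * k).+1`!%:R)^-1 *: 'X^k.

(* cosh (sqrt w) and sinh (sqrt w) / sqrt w *)
Definition coshs := pseries_sum coshq.
Definition sinhs := pseries_sum sinhq.

(** The number (2r)^k / k! is one term of the exponential series, hence at most [expR (2 * r)]. A
    lower bound on [a] is enough, which covers [coshq] and [sinhq] together. *)
Lemma pseries_cvg_fact (a : nat -> nat) : (forall k, (k`! <= a k)%N) ->
  pseries_cvg (fun k => ((a k)%:R : R[i])^-1 *: 'X^k).
Proof.
move=> Ha r r0; exists (expR (2 * r)) => k.
rewrite pnormZ pnormXn normcV normc_nat ler_pdivlMr ?exprn_gt0 //.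
have fk : (0 : R) < k`!%:R by rewrite ltr0n fact_gt0.
have ak : (0 : R) < (a k)%:R by rewrite ltr0n (leq_trans _ (Ha k)) ?fact_gt0.
have h : (2 * r) ^+ k / k`!%:R <= expR (2 * r).
  case: k {Ha fk ak} => [|k].
    by rewrite expr0 fact0 divr1 -expR0 ler_expR mulr_ge0.
  by apply: le_trans (expR_ge1Dxn k _); rewrite ?mulr_ge0 // lerDr.
apply: le_trans h; rewrite -mulrA -exprMn [r * 2]mulrC [leLHS]mulrC.
by rewrite ler_wpM2l ?exprn_ge0 ?mulr_ge0 // lef_pV2 ?posrE // ler_nat.
Qed.

Lemma coshq_cvg : pseries_cvg coshq.
Proof. by apply: pseries_cvg_fact => k; rewrite leq_fact // leq_pmull. Qed.

Lemma sinhq_cvg : pseries_cvg sinhq.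
Proof. by apply: pseries_cvg_fact => k; rewrite leq_fact // leqW // leq_pmull. Qed.


Lemma is_diff_littleoP (e : Cn R -> Cn R) (z : Cn R) (df : R[i] -> R[i]) :
  is_diff z e df -> forall eps : R, 0 < eps -> exists2 delta : R, 0 < delta &
    forall h : R[i], normc h < delta -> normc (e (z + h) - e z - df h) <= eps * normc h.
Proof.
move=> [/diff_locallyP[_ /eqaddoP H] Edf] eps eps0.
have /nbhs_ballP[d /= d0 Hd] := H eps%:C (etrans (ltcR _ _) eps0).
have /complex_realP[d' E] : d \is Num.real by rewrite gtr0_real.
exists d'; first by rewrite -ltcR -E.
move=> h hd; have := Hd h; rewrite -ball_normE /= sub0r normrN E => /(_ _).
rewrite ltcR => /(_ hd).
have -> : (e \o shift z - (cst (e z) + 'd e z)) h = e (z + h) - e z - df h :> R[i].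
  by rewrite -Edf [z + h]addrC -[RHS]addrA -opprD.
have -> : eps%:C * `|id h| = (eps * normc h)%:C by rewrite rmorphM.
by move=> Hx; rewrite -lecR; exact: Hx.
Qed.

Lemma is_derive0_littleo (phi : R -> R) (t : R) :
  (forall eps : R, 0 < eps -> exists2 delta : R, 0 < delta &
    forall h, `|h| < delta -> `|phi (t + h) - phi t| <= eps * `|h|) ->
  is_derive t (1 : R) phi 0.
Proof.
move=> H.
have oD : phi \o shift t = cst (phi t) + \0 +o_ 0 id.
  apply/eqaddoP => eps eps0; have [d d0 Hd] := H _ eps0.
  apply/nbhs_ballP; exists d => // h; rewrite -ball_normE /= sub0r normrN => hd.
  have -> : (phi \o shift t - (cst (phi t) + \0)) h = phi (t + h) - phi t.
    by rewrite [t + h]addrC -[phi (h + t) - phi t]/(phi (h + t) - phi t); congr (_ - _); exact: addr0.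
  exact: Hd.
have U : 'd phi t = \0 :> (R -> R) by apply: diff_unique oD; exact: cst_continuous.
have dphi : differentiable phi t by apply/diff_locallyP; rewrite U; split=> //; exact: cst_continuous.
by split; [exact/derivable1_diffP|rewrite deriveE // U].
Qed.

(** Along the real line through 0 and [w], the real and imaginary parts of [e] are real functions
    with zero derivative. *)
Lemma is_diff0_cst (e : Cn R -> Cn R) (w : Cn R) :
  (forall z : Cn R, is_diff z e (fun=> 0 : R[i])) -> e w = e 0.
Proof.
move=> H.
have P (pr : R[i] -> R) : (forall x y, pr (x - y) = pr x - pr y) ->
    (forall x, `|pr x| <= normc x) -> pr (e w) = pr (e 0).
  move=> prB prn; pose phi (t : R) := pr (e (t%:C * (w : R[i]))).
  have -> : e w = e ((1 : R)%:C * (w : R[i])) by rewrite mul1r.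
  have -> : e 0 = e ((0 : R)%:C * (w : R[i])) by rewrite mul0r.
  apply: (@is_derive_0_is_cst R phi) => t; apply: is_derive0_littleo => eps eps0.
  have w1 : 0 < normc w + 1 by rewrite ltr_wpDl ?normc_ge0.
  have [d d0 Hd] := is_diff_littleoP (H (t%:C * (w : R[i]))) (divr_gt0 eps0 w1).
  exists (d / (normc w + 1)); first exact: divr_gt0.
  move=> h; rewrite ltr_pdivlMr // => hd.
  have hw : normc (h%:C * (w : R[i])) <= `|h| * (normc w + 1).
    by rewrite normcM normc_real ler_wpM2l // lerDl.
  have := Hd _ (le_lt_trans hw hd); rewrite -mulrDl -rmorphD subr0 => He.
  rewrite /phi -prB; apply: le_trans (prn _) _; apply: le_trans He _.
  rewrite mulrAC ler_pdivrMr // -mulrA ler_wpM2l //; exact: ltW.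
have h1 := (P (@Re R))^~ (@ler_Re_normc R); have h2 := (P (@Im R))^~ (@ler_Im_normc R).
apply/eqP; rewrite eq_complex; apply/andP; split; apply/eqP.
  by apply: h1 => -[? ?] [].
by apply: h2 => -[? ?] [].
Qed.

Lemma coshs_deriv w : 2 * csum (fun k => (coshq k)^`().[w]) = sinhs w.
Proof.
have [M [_ H]] := pseries_dominated w coshq_cvg.
have H' : geom_dominated M (fun k => (coshq k.+1)^`().[w]).
  move=> k; apply: le_trans (H k.+1) _; rewrite ler_wpM2l ?(geom_dominated_ge0 H) //.
  by rewrite lef_pV2 ?posrE ?exprn_gt0 // ler_eXn2l // ltr1n.
rewrite (csum_recl H) /coshq derivZ hornerZ derivXn mulr0n horner0 mulr0 add0r.
rewrite -(csumZ 2 H') /sinhs /pseries_sum; congr csum; apply/funext => k.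
rewrite /coshq /sinhq derivZ derivXn !hornerZ hornerMn !hornerXn.
rewrite mulnS add2n factS natrM invfM -[w ^+ _ *+ _]mulr_natl.
have -> : ((2 * k).+2%:R : R[i]) = 2 * k.+1%:R by rewrite -natrM mulnS.
have nz : ((2 * k).+1`!%:R : R[i]) != 0 by rewrite pnatr_eq0 -lt0n fact_gt0.
have nz2 : (k.+1%:R : R[i]) != 0 by rewrite pnatr_eq0.
move: (_`!%:R) (k.+1%:R) nz nz2 => a b a0 b0.
by field; rewrite a0 b0.
Qed.

(** The differential equation of sinh(s) / s in the variable w = s^2. The factor [w] is kept on the
    left, so the point 0 is included. *)
Lemma sinhs_deriv w : 2 * w * csum (fun k => (sinhq k)^`().[w]) = coshs w - sinhs w.
Proof.
have [M [_ H]] := pseries_dominated w sinhq_cvg.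
have [M1 [H1 _]] := pseries_dominated w sinhq_cvg.
have [M2 [H2 _]] := pseries_dominated w coshq_cvg.
rewrite -(csumZ _ H) -(csumB H2 H1); congr csum; apply/funext => k.
rewrite /coshq /sinhq derivZ derivXn !hornerZ hornerMn !hornerXn.
rewrite factS natrM invfM -[w ^+ _ *+ _]mulr_natl.
have nz : ((2 * k)`!%:R : R[i]) != 0 by rewrite pnatr_eq0 -lt0n fact_gt0.
have nz2 : ((2 * k).+1%:R : R[i]) != 0 by rewrite pnatr_eq0.
have E : ((2 * k).+1%:R : R[i]) = 2 * k%:R + 1 by rewrite -natr1 natrM.
rewrite E in nz2 *.
case: k nz nz2 {E} => [|k] nz nz2 /=; first by rewrite !expr0; field; rewrite nz.
rewrite exprS; move: (_`!%:R) (k.+1%:R) nz nz2 => a b a0 b0.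
by field; rewrite a0 b0.
Qed.

Lemma is_diff_coshs (z : Cn R) :
  is_diff z (coshs : Cn R -> Cn R) (fun h : R[i] => h * (sinhs z / 2)).
Proof.
have := is_diff_pseries z coshq_cvg.
by rewrite -coshs_deriv mulrC mulKf // pnatr_eq0.
Qed.

Lemma entire_coshs : entire coshs.
Proof. exact: entire_pseries coshq_cvg. Qed.

Lemma entire_sinhs : entire sinhs.
Proof. exact: entire_pseries sinhq_cvg. Qed.

Lemma coshs0 : coshs 0 = 1.
Proof.
rewrite /coshs /pseries_sum (@csum_fin _ 1).
  by rewrite big_ord1 /coshq hornerZ hornerXn expr0 muln0 fact0 invr1 mulr1.
by case=> // k _; rewrite /coshq hornerZ hornerXn expr0n mulr0.
Qed.

Lemma sinhs0 : sinhs 0 = 1.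
Proof.
rewrite /sinhs /pseries_sum (@csum_fin _ 1).
  by rewrite big_ord1 /sinhq hornerZ hornerXn expr0 muln0 (_ : 1`! = 1%N) // invr1 mulr1.
by case=> // k _; rewrite /sinhq hornerZ hornerXn expr0n mulr0.
Qed.

(** With C and S for the two functions, the left side has derivative S (C - S - 2wS'), which
    vanishes by [sinhs_deriv]; its value at 0 is 1. *)
Lemma coshs_sinhs w : coshs w ^+ 2 - w * sinhs w ^+ 2 = 1.
Proof.
pose e (z : Cn R) : Cn R := coshs z * coshs z - z * (sinhs z * sinhs z).
have H (z : Cn R) : is_diff z e (fun=> 0 : R[i]).
  have dC := is_diff_coshs z.
  have dS := is_diff_pseries z sinhq_cvg.
  have := is_diff_subL (is_diff_mulL dC dC)
    (is_diff_mulL (is_diff_id z) (is_diff_mulL dS dS)).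
  move=> /is_diff_eq; apply; apply/funext => h.
  have := sinhs_deriv z; rewrite -/sinhs; set S' := csum _; move: S' => S' E.
  have -> : coshs z = 2 * z * S' + sinhs z by rewrite E subrK.
  by rewrite /=; field.
have := is_diff0_cst w H.
by rewrite /e coshs0 sinhs0 mul0r subr0 mulr1 !expr2.
Qed.

End HyperbolicFunctions.

(** * Real values of the hyperbolic functions and real flow times *)

Section RealTimes.
Variable R : realType.

Lemma csum_real M (v : nat -> R) : geom_dominated M (fun k => (v k)%:C) ->
  (forall k, 0 <= v k) -> exists2 y : R, csum (fun k => (v k)%:C) = y%:C & v 0%N <= y.
Proof.
move=> H v0; have [cv _] := geom_real_cvg (geom_Re H).
exists (limn (series v)).
  rewrite /csum /=; congr (_ +i* _).
  apply: (@lim_near_cst R^o); first exact: Rhausdorff.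
  by exists 0%N => // n _; rewrite /series /= big1.
apply: limr_ge => //; exists 1%N => // n /= n1.
rewrite /series /= big_ltn // lerDl; exact: sumr_ge0.
Qed.

(** All terms are nonnegative reals, and the one of index 0 is 1. *)
Lemma real_factorial_series (a : nat -> nat) (x : R) :
  pseries_cvg (fun k => ((a k)%:R : R[i])^-1 *: 'X^k) -> 0 <= x -> a 0%N = 1%N ->
  exists2 y : R, pseries_sum (fun k => ((a k)%:R : R[i])^-1 *: 'X^k) x%:C = y%:C & 1 <= y.
Proof.
move=> cv x0 a0; have [M [H _]] := pseries_dominated x%:C cv.
pose v k := (a k)%:R^-1 * x ^+ k.
have E : (fun k => (((a k)%:R : R[i])^-1 *: 'X^k).[x%:C]) = (fun k => (v k)%:C).
  apply/funext => k; rewrite hornerZ hornerXn rmorphM fmorphV rmorph_nat rmorphXn.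
  by [].
rewrite E in H; have [|y Hy y1] := csum_real H.
  by move=> k; rewrite mulr_ge0 ?invr_ge0 ?exprn_ge0.
exists y; first by rewrite /pseries_sum E.
by apply: le_trans y1; rewrite /v a0 expr0 invr1 mulr1.
Qed.

Lemma coshs_real (x : R) : 0 <= x -> exists2 y : R, coshs x%:C = y%:C & 1 <= y.
Proof. by move=> x0; apply: real_factorial_series x0 _ => //; exact: coshq_cvg. Qed.

Lemma sinhs_real (x : R) : 0 <= x -> exists2 y : R, sinhs x%:C = y%:C & 1 <= y.
Proof. by move=> x0; apply: real_factorial_series x0 _ => //; exact: sinhq_cvg. Qed.

Lemma entire_Re_continuous (e : R[i] -> R[i]) : entire e ->
  continuous (fun t : R => Re (e t%:C)).
Proof.
move=> ee t; apply/cvgrPdist_le => /= eps eps0.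
have /cvgrPdist_le/= := differentiable_continuous (ee t%:C).
move=> /(_ eps%:C); rewrite ltcR => /(_ eps0) /nbhs_ballP[d /= d0 Hd].
have /complex_realP[d' E] : d \is Num.real by rewrite gtr0_real.
apply/nbhs_ballP; exists d'; first by rewrite /= -ltcR -E.
move=> s /= ts'; have ts : `|t - s| < d' by exact: ts'.
have H : normc (e t%:C - e s%:C) <= eps.
  have bs : ball (t%:C : Cn R) d (s%:C : Cn R).
    rewrite -ball_normE /= E.
    have -> : `|(t%:C : Cn R) - s%:C| = `|t - s|%:C by rewrite -normc_real rmorphB.
    by rewrite ltcR.
  by rewrite -lecR; exact: Hd bs.
apply: le_trans H; apply: le_trans (ler_Re_normc _).
by case: (e t%:C) (e s%:C) => [? ?] [].
Qed.

(** The left side is odd in [t]. For [0 <= b] it is 0 at 0 and at least [b] at [b], because [sinhs]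
    is at least 1 on nonnegative reals; the intermediate value theorem concludes. *)
Lemma sinhs_time_surj (D b : R) : 0 < D ->
  exists t : R, t%:C * sinhs (t ^+ 2 * D)%:C = b%:C.
Proof.
move=> D0; wlog b0 : b / 0 <= b.
  move=> H; have [b0|/ltW b0] := leP 0 b; first exact: H.
  have [|t Ht] := H (- b); first by rewrite oppr_ge0.
  by exists (- t); rewrite sqrrN rmorphN mulNr Ht rmorphN opprK.
pose e (z : R[i]) : R[i] := z * sinhs (z * z * D%:C).
have ee : entire e.
  move=> z; have dS := differentiableP (@entire_sinhs R ((z : R[i]) * z * D%:C)).
  have di := is_diff_id (z : Cn R).
  have dz : is_diff z (fun q : Cn R => q * q * (D%:C : Cn R)) _ :=
    is_diff_mulL (is_diff_mulL di di) (is_diff_cstL (D%:C : Cn R) z).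
  have := is_diff_mulL di (is_diff_comp dz dS).
  by case.
have eE (t : R) : e t%:C = t%:C * sinhs (t ^+ 2 * D)%:C.
  by rewrite /e expr2 !rmorphM.
have er (t : R) : exists2 y : R, e t%:C = (t * y)%:C & 1 <= y.
  have [|y Hy y1] := @sinhs_real (t ^+ 2 * D); first by rewrite mulr_ge0 ?sqr_ge0 ?ltW.
  by exists y => //; rewrite eE Hy rmorphM.
have [||c _ Hc] := @IVT R (fun c : R => Re (e c%:C)) 0 b b b0.
- exact/continuous_subspaceT/entire_Re_continuous.
- have [y0 -> _] := er 0; have [y -> y1] := er b; rewrite /= mul0r.
  by rewrite ge_min le_max b0 /= ler_peMr // orbT.
by exists c; rewrite -eE; have [y Ey _] := er c; rewrite -Hc Ey.
Qed.

(* The equation solved for t is a + b sqrt D = exp (t sqrt D). *)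
Lemma pell_time (D a b : R) : 0 < D -> 0 < a -> a ^+ 2 - D * b ^+ 2 = 1 ->
  exists t : R, coshs (t%:C ^+ 2 * D%:C) = a%:C /\ t%:C * sinhs (t%:C ^+ 2 * D%:C) = b%:C.
Proof.
move=> D0 a0 E; have [t Ht] := sinhs_time_surj b D0.
have E2 : t%:C ^+ 2 * D%:C = (t ^+ 2 * D)%:C by rewrite rmorphM rmorphXn.
exists t; rewrite E2; split => //.
have [|y Hy y1] := @coshs_real (t ^+ 2 * D); first by rewrite mulr_ge0 ?sqr_ge0 ?ltW.
have [|s Hs s1] := @sinhs_real (t ^+ 2 * D); first by rewrite mulr_ge0 ?sqr_ge0 ?ltW.
have := coshs_sinhs (t ^+ 2 * D)%:C; move: Ht; rewrite Hy Hs => Ht.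
have {}Ht : t * s = b by apply: complexI; rewrite rmorphM.
rewrite -!rmorphXn -rmorphM -rmorphB => /complexI E3.
(* Both numbers are nonnegative with square [1 + D * b ^+ 2]. *)
congr (_%:C); apply/eqP; rewrite -(eqrXn2 (n := 2)) //; last 2 first.
- exact: le_trans y1.
- exact: ltW.
apply/eqP; move: E E3; rewrite -Ht; lra.
Qed.

End RealTimes.

(** * Volume-preserving automorphisms preserving the Markov polynomial *)

Section Toolkit2.
Variables (K : numFieldType) (V : normedModType K).

Lemma is_diff_entry m n (M : 'M[K]_(m, n)) i j :
  is_diff M (fun N : 'M[K]_(m, n) => N i j : K) (fun N : 'M[K]_(m, n) => N i j : K).
Proof.
have @f : {linear 'M[K]_(m, n) -> K}.
  by exists (fun N : 'M[K]_(_, _) => N i j); do 2![eexists]; do ?[constructor];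
     rewrite ?mxE// => ? *; rewrite ?mxE//; move=> ?; rewrite !mxE.
rewrite (_ : (fun _ => _) = f) //.
have cf : continuous f by exact: coord_continuous.
by split; [exact: linear_differentiable|exact: diff_lin].
Qed.

Definition row3 (a b c : K) : 'rV[K]_3 :=
  \row_(j < 3) (if j == i0 then a else if j == i1 then b else c).

Lemma row3E a b c : row3 a b c = a *: row3 1 0 0 + b *: row3 0 1 0 + c *: row3 0 0 1.
Proof.
apply/rowP => j; rewrite !mxE; case: (j == i0); first by rewrite !mulr0 !addr0 mulr1.
by case: (j == i1); rewrite !mulr0 ?addr0 ?add0r mulr1.
Qed.

Lemma is_diff_scaleL (f df : V -> K) (W : normedModType K) (w : W) p : is_diff p f df ->
  is_diff p (fun q => f q *: w) (fun u => df u *: w).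
Proof.
move=> [df1 df2]; split; first exact: differentiableZl.
by rewrite diffZl // df2.
Qed.

Lemma is_diff_row3 (f g h df dg dh : V -> K) p :
  is_diff p f df -> is_diff p g dg -> is_diff p h dh ->
  is_diff p (fun q => row3 (f q) (g q) (h q)) (fun u => row3 (df u) (dg u) (dh u)).
Proof.
move=> Hf Hg Hh.
have := is_diffD (is_diffD (is_diff_scaleL (row3 1 0 0) Hf) (is_diff_scaleL (row3 0 1 0) Hg))
  (is_diff_scaleL (row3 0 0 1) Hh).
rewrite (_ : (_ + _ + _) = (fun q => row3 (f q) (g q) (h q))); last first.
  by apply/funext => q; rewrite [RHS]row3E.
move=> /is_diff_eq; apply; by apply/funext => q; rewrite [RHS]row3E.
Qed.

End Toolkit2.

(** * Volume, the gradient of the Markov polynomial and the symplectic form *)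

Section Volume.
Variable R : realType.
Implicit Types (p q u v w : C3 R) (F G : C3 R -> C3 R).

Lemma cx_pt a b c : cx (pt a b c) = a :> R[i].
Proof. by rewrite /cx /pt mxE. Qed.

Lemma cy_pt a b c : cy (pt a b c) = b :> R[i].
Proof. by rewrite /cy /pt mxE. Qed.

Lemma cz_pt a b c : cz (pt a b c) = c :> R[i].
Proof. by rewrite /cz /pt mxE. Qed.

Definition c_pt := (cx_pt, cy_pt, cz_pt).

Lemma C3_ext u v : cx u = cx v -> cy u = cy v -> cz u = cz v -> u = v.
Proof.
move=> hx hy hz; apply/rowP => -[[|[|[|//]]] Hj].
- by rewrite (_ : Ordinal Hj = i0) //; apply/val_inj.
- by rewrite (_ : Ordinal Hj = i1) //; apply/val_inj.
- by rewrite (_ : Ordinal Hj = i2) //; apply/val_inj.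
Qed.

Lemma ptK p : pt (cx p) (cy p) (cz p) = p.
Proof. by apply: C3_ext; rewrite c_pt. Qed.


Lemma is_diff_cx p : is_diff p (@cx R : C3 R -> Cn R) (@cx R).
Proof. exact: is_diff_entry. Qed.

Lemma is_diff_cy p : is_diff p (@cy R : C3 R -> Cn R) (@cy R).
Proof. exact: is_diff_entry. Qed.

Lemma is_diff_cz p : is_diff p (@cz R : C3 R -> Cn R) (@cz R).
Proof. exact: is_diff_entry. Qed.

Lemma is_diff_pt (V : normedModType (Cn R)) (f g h df dg dh : V -> Cn R) (p : V) :
  is_diff p f df -> is_diff p g dg -> is_diff p h dh ->
  is_diff p (fun q : V => pt (f q) (g q) (h q) : C3 R) (fun u : V => pt (df u) (dg u) (dh u)).
Proof. exact: is_diff_row3. Qed.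

Definition grad p u := Px p * cx u + Py p * cy u + Pz p * cz u.

Lemma is_diff_markovP p : is_diff p (@markovP R : C3 R -> Cn R) (grad p).
Proof.
have dx := is_diff_cx p; have dy := is_diff_cy p; have dz := is_diff_cz p.
have := is_diff_subL (is_diff_addL (is_diff_addL (is_diff_mulL dx dx) (is_diff_mulL dy dy))
    (is_diff_mulL dz dz))
  (is_diff_mulL (is_diff_mulL (is_diff_mulL (is_diff_cstL (3 : Cn R) p) dx) dy) dz).
rewrite (_ : (fun _ => _) = @markovP R); last first.
  by apply/funext => q; rewrite /markovP !expr2.
move=> /is_diff_eq; apply; apply/funext => u; rewrite /grad /Px /Py /Pz /=; ring.
Qed.

(** The determinant expanded along [w]: the coefficients are those of the cross product of [u] and
    [v], which [omega] compares with the gradient. *)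
Definition det3 u v w : R[i] :=
  (cy u * cz v - cz u * cy v) * cx w + (cz u * cx v - cx u * cz v) * cy w +
  (cx u * cy v - cy u * cx v) * cz w.

Definition volume_preserving F :=
  [/\ forall p, differentiable F p, forall p, markovP (F p) = markovP p &
      forall p u v w, det3 ('d F p u) ('d F p v) ('d F p w) = det3 u v w].

Definition volume_aut F := volume_preserving F /\
  exists F', [/\ volume_preserving F', cancel F F' & cancel F' F].

Lemma volume_preserving_comp F G :
  volume_preserving F -> volume_preserving G -> volume_preserving (F \o G).
Proof.
move=> [dF PF vF] [dG PG vG]; split=> [p|p|p u v w].
- exact: differentiable_comp.
- by rewrite /= PF PG.
- by rewrite diff_comp //= vF vG.
Qed.

Lemma volume_aut_comp F G : volume_aut F -> volume_aut G -> volume_aut (F \o G).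
Proof.
move=> [vF [F' [vF' FK F'K]]] [vG [G' [vG' GK G'K]]].
split; first exact: volume_preserving_comp.
exists (G' \o F'); split; first exact: volume_preserving_comp.
- by move=> p /=; rewrite FK GK.
- by move=> p /=; rewrite G'K F'K.
Qed.

Lemma volume_aut_inv F : volume_aut F ->
  exists F', [/\ volume_aut F', cancel F F' & cancel F' F].
Proof.
by move=> [vF [F' [vF' FK F'K]]]; exists F'; split=> //; split=> //; exists F.
Qed.

Lemma volume_aut_hol F : volume_aut F -> hol_aut_M F.
Proof.
have H G : volume_preserving G -> hol_map_M G.
  move=> [dG PG _]; split=> p Mp; first by rewrite /M /= PG.
  by exists G, setT; split=> //; exact: openT.
move=> [vF [F' [vF' FK F'K]]]; split; first exact: H.
by exists F'; split=> [|p _|p _]; [exact: H|exact: FK|exact: F'K].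
Qed.

(** The cross product and the gradient are both normal to the tangent plane, hence proportional. The
    cases follow those of [omega]; in each, tangency is solved for a coordinate whose partial
    derivative is nonzero. *)
Lemma cross_omega p u v : Mreg p -> tangent p u -> tangent p v ->
  [/\ cy u * cz v - cz u * cy v = omega p u v * Px p,
      cz u * cx v - cx u * cz v = omega p u v * Py p &
      cx u * cy v - cy u * cx v = omega p u v * Pz p].
Proof.
move=> [_ reg]; rewrite /tangent /omega.
move: (Px p) (Py p) (Pz p) reg (cx u) (cy u) (cz u) (cx v) (cy v) (cz v).
move=> a b c reg ux uy uz vx vy vz hu hv.
have [c0|c0] /= := eqVneq c 0; last first.
  have -> : uz = - (a * ux + b * uy) / c.
    by apply: (mulIf c0); rewrite divfK // -[RHS]addr0 -hu; ring.
  have -> : vz = - (a * vx + b * vy) / c.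
    by apply: (mulIf c0); rewrite divfK // -[RHS]addr0 -hv; ring.
  by split; field.
have [a0|a0] /= := eqVneq a 0; last first.
  have -> : ux = - (b * uy + c * uz) / a.
    by apply: (mulIf a0); rewrite divfK // -[RHS]addr0 -hu; ring.
  have -> : vx = - (b * vy + c * vz) / a.
    by apply: (mulIf a0); rewrite divfK // -[RHS]addr0 -hv; ring.
  by split; field.
have b0 : b != 0 by apply/eqP => b0; apply: reg.
have -> : uy = - (a * ux + c * uz) / b.
  by apply: (mulIf b0); rewrite divfK // -[RHS]addr0 -hu; ring.
have -> : vy = - (a * vx + c * vz) / b.
  by apply: (mulIf b0); rewrite divfK // -[RHS]addr0 -hv; ring.
by split; field.
Qed.

Lemma omega_of_cross p u v c : ~ (Px p = 0 /\ Py p = 0 /\ Pz p = 0) ->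
  cy u * cz v - cz u * cy v = c * Px p ->
  cz u * cx v - cx u * cz v = c * Py p ->
  cx u * cy v - cy u * cx v = c * Pz p -> omega p u v = c.
Proof.
move=> reg hx hy hz; rewrite /omega hx hy hz.
have [c0|c0] /= := eqVneq (Pz p) 0; last by rewrite mulfK.
have [a0|a0] /= := eqVneq (Px p) 0; last by rewrite mulfK.
have b0 : Py p != 0 by apply/eqP => b0; apply: reg.
by rewrite mulfK.
Qed.

Lemma volume_grad F p w : volume_preserving F -> grad (F p) ('d F p w) = grad p w.
Proof.
move=> [dF PF _].
have cmp := is_diff_comp (differentiableP (dF p)) (is_diff_markovP (F p)).
have E : (@markovP R : C3 R -> Cn R) \o F = @markovP R by apply/funext => q; exact: PF.
have {}cmp := eq_rect _ (fun f : C3 R -> Cn R => is_diff p f _) cmp _ E.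
by have := etrans (esym (diff_val (is_diff_def := cmp))) (diff_val (is_diff_def := is_diff_markovP p));
  move=> /(congr1 (fun f => f w)).
Qed.

(** Preservation of [det3] and of the gradient pairing shows that the cross product of the image
    vectors pairs with each ['d F p w] as [omega p u v] times the gradient at [F p] does. Since
    ['d F p] is onto, the two vectors are equal. *)
Lemma volume_aut_omega F p u v : volume_aut F -> Mreg p -> tangent p u -> tangent p v ->
  omega (F p) ('d F p u) ('d F p v) = omega p u v.
Proof.
move=> [vF [F' [vF' FK F'K]]] reg tu tv.
have [cX cY cZ] := cross_omega reg tu tv.
have gF := volume_grad _ _ vF.
have [dF _ detF] := vF; have [dF' _ _] := vF'.
have surj w : exists w', 'd F p w' = w.
  exists ('d F' (F p) w).
  have cmp := is_diff_comp (differentiableP (dF' (F p))) (differentiableP (dF (F' (F p)))).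
  have E : F \o F' = id by apply/funext => q; exact: F'K.
  have {}cmp := eq_rect _ (fun f : C3 R -> C3 R => is_diff (F p) f _) cmp _ E.
  rewrite (FK p) in cmp.
  have := etrans (esym (diff_val (is_diff_def := cmp))) (diff_val (is_diff_def := is_diff_id (F p))).
  by move=> /(congr1 (fun f => f w)).
have key w : det3 ('d F p u) ('d F p v) w = omega p u v * grad (F p) w.
  have [w' <-] := surj w; rewrite detF gF /det3 cX cY cZ /grad; ring.
have k0 := key (pt 1 0 0); have k1 := key (pt 0 1 0); have k2 := key (pt 0 0 1).
apply: omega_of_cross.
(* A vanishing gradient at [F p] would pull back to a vanishing gradient at [p]. *)
- move=> [gx [gy gz]]; case: reg => _; apply.
  have g0 w : grad p w = 0 by rewrite -gF /grad gx gy gz !mul0r !addr0.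
  have := g0 (pt 1 0 0); have := g0 (pt 0 1 0); have := g0 (pt 0 0 1).
  by rewrite /grad !c_pt !mulr0 !mulr1 ?addr0 ?add0r => -> -> ->.
- by move: k0; rewrite /det3 /grad !c_pt !mulr0 !mulr1 ?addr0 ?add0r.
- by move: k1; rewrite /det3 /grad !c_pt !mulr0 !mulr1 ?addr0 ?add0r.
- by move: k2; rewrite /det3 /grad !c_pt !mulr0 !mulr1 ?addr0 ?add0r.
Qed.

End Volume.

(** * Shears *)

Lemma linear_eq3 (K : numFieldType) (V W : normedModType K) (f g : {linear V -> W})
    (a b c : K) (x y z : V) :
  f x = g x -> f y = g y -> f z = g z ->
  f (a *: x + b *: y + c *: z) = g (a *: x + b *: y + c *: z).
Proof. by move=> hx hy hz; rewrite !linearD !linearZ /= hx hy hz. Qed.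

Section Shears.
Variable R : realType.
Implicit Types (p q u v w : C3 R) (F G : C3 R -> C3 R) (a b : R[i]).

(** The matrix a I + b B on (y, z), where B is the Hamiltonian field of x, linear on each fibre. As
    B^2 = (9x^2 - 4) I, such matrices multiply like the numbers a + b sqrt(9x^2 - 4), and the Pell
    expression is the determinant. *)
Definition pell_step a b p : C3 R :=
  pt (cx p) (a * cy p + b * (2 * cz p - 3 * cx p * cy p))
            (a * cz p + b * (3 * cx p * cz p - 2 * cy p)).

Definition disc (x : R[i]) := 9 * (x * x) - 4.

Lemma markovP_pell_step a b p : a ^+ 2 - disc (cx p) * b ^+ 2 = 1 ->
  markovP (pell_step a b p) = markovP p.
Proof.
rewrite /markovP /pell_step !c_pt.
move: (cx p) (cy p) (cz p) => x y z E.
(* The step multiplies the quadratic form in y and z by its determinant. *)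
transitivity (x ^+ 2 + (a ^+ 2 - disc x * b ^+ 2) * (y ^+ 2 + z ^+ 2 - 3 * x * y * z)).
  by rewrite /disc; ring.
by rewrite E; ring.
Qed.

Lemma pell_stepK a b p : a ^+ 2 - disc (cx p) * b ^+ 2 = 1 ->
  pell_step a (- b) (pell_step a b p) = p.
Proof.
move=> E; apply: C3_ext; rewrite /pell_step !c_pt //; move: E;
  move: (cx p) (cy p) (cz p) => x y z E.
- transitivity ((a ^+ 2 - disc x * b ^+ 2) * y); first by rewrite /disc; ring.
  by rewrite E mul1r.
- transitivity ((a ^+ 2 - disc x * b ^+ 2) * z); first by rewrite /disc; ring.
  by rewrite E mul1r.
Qed.

Lemma entire_is_diff (e : R[i] -> R[i]) (z : Cn R) : entire e ->
  exists d : R[i], is_diff z (e : Cn R -> Cn R) (fun h : R[i] => h * d).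
Proof.
move=> ee; exists (derive1 (e : Cn R -> Cn R) z).
by split; [exact: ee|exact: diff1E (ee z)].
Qed.

Definition shear (A B : R[i] -> R[i]) p := pell_step (A (cx p)) (B (cx p)) p.

Lemma volume_preserving_shear (A B : R[i] -> R[i]) : entire A -> entire B ->
  (forall z, A z ^+ 2 - disc z * B z ^+ 2 = 1) -> volume_preserving (shear A B).
Proof.
move=> eA eB E.
(* The differential is block triangular: everything multiplied by [cx u], including the derivatives
   [A'] and [B'], drops out of [det3], leaving the determinant of the block on (y, z). *)
have H p : exists A' B' : R[i], is_diff p (shear A B) (fun u : C3 R =>
    pt (cx u)
     (A (cx p) * cy u + B (cx p) * (2 * cz u - 3 * (cx p * cy u + cx u * cy p)) +
      cx u * (A' * cy p + B' * (2 * cz p - 3 * cx p * cy p)))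
     (A (cx p) * cz u + B (cx p) * (3 * (cx p * cz u + cx u * cz p) - 2 * cy u) +
      cx u * (A' * cz p + B' * (3 * cx p * cz p - 2 * cy p)))).
  have [A' dA] := entire_is_diff (cx p) eA.
  have [B' dB] := entire_is_diff (cx p) eB.
  exists A', B'.
  have dx := is_diff_cx p; have dy := is_diff_cy p; have dz := is_diff_cz p.
  have d2 := is_diff_cstL (2 : Cn R) p; have d3 := is_diff_cstL (3 : Cn R) p.
  have dAx := is_diff_compL dx dA; have dBx := is_diff_compL dx dB.
  have dL := is_diff_subL (is_diff_mulL d2 dz) (is_diff_mulL (is_diff_mulL d3 dx) dy).
  have dK := is_diff_subL (is_diff_mulL (is_diff_mulL d3 dx) dz) (is_diff_mulL d2 dy).
  have := is_diff_pt dx (is_diff_addL (is_diff_mulL dAx dy) (is_diff_mulL dBx dL))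
    (is_diff_addL (is_diff_mulL dAx dz) (is_diff_mulL dBx dK)).
  move=> /is_diff_eq; apply; apply/funext => u.
  by apply: C3_ext; rewrite !c_pt //; ring.
split=> p.
- by have [A' [B' []]] := H p.
- exact: markovP_pell_step.
- move=> u v w; have [A' [B' [_ ->]]] := H p.
  transitivity ((A (cx p) ^+ 2 - disc (cx p) * B (cx p) ^+ 2) * det3 u v w); last first.
    by rewrite E mul1r.
  rewrite /det3 !c_pt /disc.
  move: (cx p) (cy p) (cz p) (cx u) (cy u) (cz u) (cx v) (cy v) (cz v) (cx w) (cy w) (cz w) (A (cx p)) (B (cx p)).
  by move=> x y z ux uy uz vx vy vz wx wy wz a b; ring.
Qed.

Lemma volume_aut_shear (A B : R[i] -> R[i]) : entire A -> entire B ->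
  (forall z, A z ^+ 2 - disc z * B z ^+ 2 = 1) -> volume_aut (shear A B).
Proof.
move=> eA eB E.
have eB' : entire (fun z => - B z) by move=> z; exact/differentiableN/eB.
split; first exact: volume_preserving_shear.
exists (shear A (fun z => - B z)); split.
- by apply: volume_preserving_shear => // z; rewrite sqrrN.
- move=> p; rewrite /shear [in cx (pell_step _ _ _)]/pell_step c_pt; exact: pell_stepK.
- move=> p; rewrite /shear [in cx (pell_step _ _ _)]/pell_step c_pt.
  by rewrite -[X in pell_step _ X _]opprK pell_stepK // sqrrN.
Qed.

(** With s = f(z) sqrt(disc z), this is cosh s, and [time_sinh] is sinh s / sqrt(disc z): the
    coefficients of exp(f(z) B). Passing through s^2 keeps them entire. *)
Definition time_cosh (f : R[i] -> R[i]) z := coshs (f z ^+ 2 * disc z).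
Definition time_sinh (f : R[i] -> R[i]) z := f z * sinhs (f z ^+ 2 * disc z).

Definition shearx f := shear (time_cosh f) (time_sinh f).

Lemma time_pell f z : time_cosh f z ^+ 2 - disc z * time_sinh f z ^+ 2 = 1.
Proof.
rewrite /time_cosh /time_sinh exprMn mulrA [disc z * _]mulrC; exact: coshs_sinhs.
Qed.

Lemma volume_aut_shearx f : entire f -> volume_aut (shearx f).
Proof.
move=> ef.
have dw (z : Cn R) : differentiable (fun z : Cn R => f z ^+ 2 * disc z : Cn R) z.
  have df := differentiableP (ef z); have di := is_diff_id z.
  have := is_diff_mulL (is_diff_mulL df df) (is_diff_subL
    (is_diff_mulL (is_diff_cstL (9 : Cn R) z) (is_diff_mulL di di)) (is_diff_cstL (4 : Cn R) z)).
  by rewrite (_ : (fun _ => _) = (fun z : Cn R => f z ^+ 2 * disc z : Cn R)) // => -[].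
apply: volume_aut_shear; last exact: time_pell.
- by move=> z; apply: (differentiable_comp (dw z)); exact: entire_coshs.
- move=> z; have ds := differentiable_comp (dw z) (@entire_sinhs R (f z ^+ 2 * disc z)).
  exact: (differentiableM (ef z) ds).
Qed.

Definition cyc p : C3 R := pt (cy p) (cz p) (cx p).
Definition cycV p : C3 R := pt (cz p) (cx p) (cy p).

Lemma cycK : cancel cyc cycV.
Proof. by move=> p; apply: C3_ext; rewrite /cyc /cycV !c_pt. Qed.

Lemma cycVK : cancel cycV cyc.
Proof. by move=> p; apply: C3_ext; rewrite /cyc /cycV !c_pt. Qed.

Lemma is_diff_cyc p : is_diff p cyc cyc.
Proof. exact: (is_diff_pt (is_diff_cy p) (is_diff_cz p) (is_diff_cx p)). Qed.

Lemma is_diff_cycV p : is_diff p cycV cycV.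
Proof. exact: (is_diff_pt (is_diff_cz p) (is_diff_cx p) (is_diff_cy p)). Qed.

Lemma volume_aut_cyc : volume_aut cyc.
Proof.
split.
- split=> [p|p|p u v w]; first by have [] := is_diff_cyc p.
  + by rewrite /markovP /cyc !c_pt; ring.
  + by have [_ ->] := is_diff_cyc p; rewrite /det3 /cyc !c_pt; ring.
- exists cycV; split; [|exact: cycK|exact: cycVK].
  split=> [p|p|p u v w]; first by have [] := is_diff_cycV p.
  + by rewrite /markovP /cycV !c_pt; ring.
  + by have [_ ->] := is_diff_cycV p; rewrite /det3 /cycV !c_pt; ring.
Qed.

Lemma volume_aut_cycV : volume_aut cycV.
Proof.
have [F' [vF' _ F'K]] := volume_aut_inv volume_aut_cyc.
suff -> : cycV = F' by [].
by apply/funext => p; rewrite -{1}[p]F'K cycK.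
Qed.

Definition flow p (t : Cn R) : C3 R :=
  pell_step (coshs (t * t * disc (cx p))) (t * sinhs (t * t * disc (cx p))) p.

Lemma markovP_flow p t : markovP (flow p t) = markovP p.
Proof.
apply: markovP_pell_step; rewrite -[RHS](coshs_sinhs (t * t * disc (cx p))).
by move: (coshs _) (sinhs _) => c s; ring.
Qed.

Lemma flow0 p : flow p 0 = p.
Proof.
rewrite /flow !mul0r coshs0 /pell_step.
by apply: C3_ext; rewrite !c_pt // mul1r mul0r addr0.
Qed.

Lemma is_diff_flow p : is_diff (0 : Cn R) (flow p)
  (fun h : R[i] => pt 0 (h * Pz p) (h * - Py p)).
Proof.
have di := is_diff_id (0 : Cn R).
have dc (c : R[i]) := is_diff_cstL (c : Cn R) (0 : Cn R).
have dw := is_diff_mulL (is_diff_mulL di di) (dc (disc (cx p))).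
have dC := is_diff_compL dw (is_diff_coshs (0 * 0 * disc (cx p))).
have [d dS'] := entire_is_diff (0 * 0 * disc (cx p)) (@entire_sinhs R).
have dS := is_diff_mulL di (is_diff_compL dw dS').
have := is_diff_pt (dc (cx p))
  (is_diff_addL (is_diff_mulL dC (dc (cy p))) (is_diff_mulL dS (dc (2 * cz p - 3 * cx p * cy p))))
  (is_diff_addL (is_diff_mulL dC (dc (cz p))) (is_diff_mulL dS (dc (3 * cx p * cz p - 2 * cy p)))).
move=> /is_diff_eq; apply; apply/funext => h.
by apply: C3_ext; rewrite !c_pt // /Pz /Py !mul0r sinhs0; ring.
Qed.

(** [F] and [G] agree on the curve for small times, so their composites with [gam] have the same
    derivative at 0; the chain rule transfers this to the velocity. *)
Lemma diff_eq_along F G p (U : set (C3 R)) (gam : Cn R -> C3 R) dgam :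
  differentiable F p -> differentiable G p -> open U -> U p ->
  (forall q, U q -> M q -> G q = F q) ->
  gam 0 = p -> is_diff (0 : Cn R) gam dgam -> (forall t, M (gam t)) ->
  'd G p (dgam 1) = 'd F p (dgam 1).
Proof.
move=> dF dG oU Up GF gam0 [dgam1 <-] Mgam; subst p.
have cF := differentiable_comp dgam1 dF; have cG := differentiable_comp dgam1 dG.
have near0 : \forall t \near (0 : Cn R), (G \o gam) t = (F \o gam) t.
  have nU : nbhs (gam 0) U by apply: open_nbhs_nbhs.
  have nh : nbhs (0 : Cn R) (gam @^-1` U) by exact: differentiable_continuous dgam1 _ nU.
  by apply: filterS nh => t Ut; exact: GF.
have E1 := congr1 (fun f => f 1) (diff_comp dgam1 dF).
have E2 := congr1 (fun f => f 1) (diff_comp dgam1 dG).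
have E : 'D_(1 : Cn R) (G \o gam) 0 = 'D_(1 : Cn R) (F \o gam) 0.
  exact: near_eq_derive.
have D1 : 'D_(1 : Cn R) (F \o gam) 0 = 'd (F \o gam) 0 (1 : Cn R) by exact: deriveE.
have D2 : 'D_(1 : Cn R) (G \o gam) 0 = 'd (G \o gam) 0 (1 : Cn R) by exact: deriveE.
exact: etrans (esym E2) (etrans (esym D2) (etrans E (etrans D1 E1))).
Qed.

(** The right side is the cross product of the gradient with (a, b, c), a combination of the
    velocities of the Hamiltonian flows of x, y and z. A nonzero gradient yields its whole
    orthogonal plane in this way. *)
Lemma tangent_span p u : Mreg p -> tangent p u -> exists a b c : R[i],
  u = pt (b * - Pz p + c * Py p) (a * Pz p - c * Px p) (a * - Py p + b * Px p).
Proof.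
move=> [_ reg] tu; have E := ptK u; move: reg tu; rewrite /tangent.
suff H x y z : ~ (Px p = 0 /\ Py p = 0 /\ Pz p = 0) ->
    Px p * x + Py p * y + Pz p * z = 0 -> exists a b c : R[i], pt x y z =
    pt (b * - Pz p + c * Py p) (a * Pz p - c * Px p) (a * - Py p + b * Px p).
  by rewrite -{4}E; exact: H.
move: (Px p) (Py p) (Pz p) => a b c reg tu {E}.
have [c0|c0] := eqVneq c 0; last first.
  exists (y / c), (- x / c), 0.
  have -> : z = - (a * x + b * y) / c.
    by apply: (mulIf c0); rewrite divfK // -[RHS]addr0 -tu; ring.
  by apply: C3_ext; rewrite !c_pt; field.
have [a0|a0] := eqVneq a 0; last first.
  exists 0, (z / a), (- y / a).
  have -> : x = - (b * y + c * z) / a.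
    by apply: (mulIf a0); rewrite divfK // -[RHS]addr0 -tu; ring.
  by apply: C3_ext; rewrite !c_pt; field.
have b0 : b != 0 by apply/eqP => b0; apply: reg.
exists (- z / b), 0, (x / b).
have -> : y = - (a * x + c * z) / b.
  by apply: (mulIf b0); rewrite divfK // -[RHS]addr0 -tu; ring.
by apply: C3_ext; rewrite !c_pt; field.
Qed.

(* The Hamiltonian flows of x, y, z stay in M and their velocities span the
   tangent space, so dF on tangent vectors only depends on F restricted to M. *)
Lemma diff_eq_tangent F G p (U : set (C3 R)) u :
  differentiable F p -> differentiable G p -> open U -> U p ->
  (forall q, U q -> M q -> G q = F q) -> Mreg p -> tangent p u ->
  'd G p u = 'd F p u.
Proof.
move=> dF dG oU Up GF reg tu; have Mp : M p by case: reg.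
have H gam dgam : gam 0 = p -> is_diff (0 : Cn R) gam dgam -> (forall t, M (gam t)) ->
    'd G p (dgam 1) = 'd F p (dgam 1).
  by move=> h1 h2 h3; exact: (diff_eq_along dF dG oU Up GF h1 h2 h3).
have Mflow q t : M q -> M (flow q t) by rewrite /M /= markovP_flow.
have Mcyc q : M q -> M (cyc q).
  by rewrite /M /= => <-; have [[_ -> _] _] := volume_aut_cyc.
have McycV q : M q -> M (cycV q).
  by rewrite /M /= => <-; have [[_ -> _] _] := volume_aut_cycV.
have hx := H _ _ (flow0 p) (is_diff_flow p) (fun t => Mflow _ t Mp).
have hy := H (cycV \o flow (cyc p)) _ (etrans (congr1 cycV (flow0 _)) (cycK p))
  (is_diff_comp (is_diff_flow (cyc p)) (is_diff_cycV _))
  (fun t => McycV _ (Mflow _ t (Mcyc _ Mp))).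
have hz := H (cyc \o flow (cycV p)) _ (etrans (congr1 cyc (flow0 _)) (cycVK p))
  (is_diff_comp (is_diff_flow (cycV p)) (is_diff_cyc _))
  (fun t => Mcyc _ (Mflow _ t (McycV _ Mp))).
have [a [b [c ->]]] := tangent_span reg tu.
set vx := pt _ _ _ in hx; set vy := (cycV \o _) 1 in hy; set vz := (cyc \o _) 1 in hz.
have -> : pt (b * - Pz p + c * Py p) (a * Pz p - c * Px p) (a * - Py p + b * Px p) =
    a *: vx + b *: vy + c *: vz.
  have sc (k : R[i]) (q : C3 R) : k *: q = pt (k * cx q) (k * cy q) (k * cz q).
    by apply: C3_ext; rewrite !c_pt /cx /cy /cz mxE.
  have ad (q q' : C3 R) : q + q' = pt (cx q + cx q') (cy q + cy q') (cz q + cz q').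
    by apply: C3_ext; rewrite !c_pt /cx /cy /cz mxE.
  rewrite !sc !ad /vx /vy /vz /cyc /cycV /=.
  by apply: C3_ext; rewrite /Px /Py /Pz !c_pt; ring.
exact: (linear_eq3 a b c hx hy hz).
Qed.

(** A local extension [G] may differ from [F] off [M], but [diff_eq_tangent] makes the differentials
    agree on the tangent vectors tested. *)
Lemma volume_aut_symp F : volume_aut F -> symp_aut F.
Proof.
move=> vF; split; first exact: volume_aut_hol.
move=> p reg G [U [oU Up dG GF]] u v tu tv.
have [[dF _ _] _] := vF.
have E w : tangent p w -> 'd G p w = 'd F p w.
  by apply: (diff_eq_tangent (dF p) (dG p Up) oU Up GF reg).
exact: etrans (congr2 (omega (F p)) (E u tu) (E v tv)) (volume_aut_omega vF reg tu tv).
Qed.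

End Shears.

(** * Positive real points of the Markov surface *)

Section PositivePoints.
Variable R : realType.
Implicit Types (x y z a b : R) (f : R[i] -> R[i]).

Definition rpt x y z : C3 R := pt x%:C y%:C z%:C.

Definition pos_markov x y z :=
  [/\ 0 < x, 0 < y, 0 < z & x ^+ 2 + y ^+ 2 + z ^+ 2 = 3 * x * y * z].

Lemma pos_markovC x y z : pos_markov x y z -> pos_markov y z x.
Proof. by move=> [x0 y0 z0 E]; split=> //; move: E; lra. Qed.

(** The equation reads (3x - 2) y z = x^2 + (y - z)^2, which forces 3x > 2. *)
Lemma pos_markov_disc x y z : pos_markov x y z -> 0 < 9 * x ^+ 2 - 4.
Proof.
move=> [x0 y0 z0 E].
have h : 0 < (3 * x - 2) * (y * z).
  have := sqr_ge0 (y - z); have := exprn_gt0 2 x0; move: E; nra.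
have : 0 < 3 * x - 2 by rewrite -(pmulr_lgt0 _ (mulr_gt0 y0 z0)).
nra.
Qed.

Lemma shearx_time x a b : 0 < 9 * x ^+ 2 - 4 -> 0 < a ->
  a ^+ 2 - (9 * x ^+ 2 - 4) * b ^+ 2 = 1 ->
  exists t : R, forall f, f x%:C = t%:C -> forall y z : R,
    shearx f (rpt x y z) =
    rpt x (a * y + b * (2 * z - 3 * x * y)) (a * z + b * (3 * x * z - 2 * y)).
Proof.
move=> D0 a0 E; have [t [tC tS]] := pell_time D0 a0 E.
exists t => f fx y z.
rewrite /shearx /shear /time_cosh /time_sinh /rpt c_pt fx.
have -> : disc x%:C = (9 * x ^+ 2 - 4)%:C.
  by rewrite /disc rmorphB rmorphM rmorphXn !rmorph_nat expr2.
rewrite tC tS /pell_step !c_pt.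
have E2 : 2%:C = 2 :> R[i] by rewrite -(rmorph_nat (real_complex R)).
have E3 : 3%:C = 3 :> R[i] by rewrite -(rmorph_nat (real_complex R)).
apply: C3_ext; rewrite !c_pt //.
- by rewrite -E2 -E3 -!rmorphM -rmorphB -rmorphM -rmorphD.
- by rewrite -E2 -E3 -!rmorphM -rmorphB -rmorphM -rmorphD.
Qed.

Lemma fibre_time x y z y' z' : pos_markov x y z -> pos_markov x y' z' ->
  exists t : R, forall f, f x%:C = t%:C -> shearx f (rpt x y z) = rpt x y' z'.
Proof.
move=> P1 P2; have D0 := pos_markov_disc P1.
have [x0 y0 z0 E1] := P1; have [_ y0' z0' E2] := P2.
have xn : x != 0 by rewrite gt_eqF.
have E1' : 2 * x ^+ 2 = 6 * x * y * z - 2 * y ^+ 2 - 2 * z ^+ 2 by move: E1; lra.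
(* Cramer's rule for (y', z') = (a I + b B)(y, z); the determinant of this system is
   [6 * x * y * z - 2 * y ^+ 2 - 2 * z ^+ 2], which equals [2 * x ^+ 2] on the surface. *)
pose a := (y' * (3 * x * z - 2 * y) - z' * (2 * z - 3 * x * y)) / (2 * x ^+ 2).
pose b := (y * z' - z * y') / (2 * x ^+ 2).
(* The quadratic form on the fibre takes the value [- x ^+ 2] at both points, so the matrix joining
   them has determinant 1. *)
have pell : a ^+ 2 - (9 * x ^+ 2 - 4) * b ^+ 2 = 1.
  have -> : a ^+ 2 - (9 * x ^+ 2 - 4) * b ^+ 2 =
      (y ^+ 2 + z ^+ 2 - 3 * x * y * z) * (y' ^+ 2 + z' ^+ 2 - 3 * x * y' * z') / x ^+ 4.
    by rewrite /a /b; field.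
  have -> : y ^+ 2 + z ^+ 2 - 3 * x * y * z = - x ^+ 2 by move: E1; lra.
  have -> : y' ^+ 2 + z' ^+ 2 - 3 * x * y' * z' = - x ^+ 2 by move: E2; lra.
  by field.
(* A real time can only give a positive hyperbolic cosine. Multiplied by [y * y'] and rewritten with
   both equations, the numerator of [a] is a sum of squares. *)
have a0 : 0 < a.
  rewrite /a divr_gt0 ?mulr_gt0 ?exprn_gt0 //.
  rewrite -(pmulr_rgt0 _ (mulr_gt0 y0 y0')).
  have -> : y * y' * (y' * (3 * x * z - 2 * y) - z' * (2 * z - 3 * x * y)) =
    y' ^+ 2 * (3 * x * y * z) + y ^+ 2 * (3 * x * y' * z')
     - 2 * y ^+ 2 * y' ^+ 2 - 2 * y * y' * z * z' by ring.
  rewrite -E1 -E2.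
  have -> : y' ^+ 2 * (x ^+ 2 + y ^+ 2 + z ^+ 2) + y ^+ 2 * (x ^+ 2 + y' ^+ 2 + z' ^+ 2)
     - 2 * y ^+ 2 * y' ^+ 2 - 2 * y * y' * z * z' =
     (y * z' - y' * z) ^+ 2 + (x * y) ^+ 2 + (x * y') ^+ 2 by ring.
  by rewrite ltr_wpDl ?addr_ge0 ?sqr_ge0 // exprn_gt0 // mulr_gt0.
have [t Ht] := shearx_time D0 a0 pell; exists t => f fx.
rewrite (Ht f fx); congr rpt; rewrite /a /b.
- transitivity (y' * ((6 * x * y * z - 2 * y ^+ 2 - 2 * z ^+ 2) / (2 * x ^+ 2))); first by field.
  by rewrite -E1' divff ?mulr1 // mulf_neq0 // expf_neq0.
- transitivity (z' * ((6 * x * y * z - 2 * y ^+ 2 - 2 * z ^+ 2) / (2 * x ^+ 2))); first by field.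
  by rewrite -E1' divff ?mulr1 // mulf_neq0 // expf_neq0.
Qed.

Definition sheary f := @cycV R \o shearx f \o @cyc R.
Definition shearz f := @cyc R \o shearx f \o @cycV R.

Lemma cyc_rpt x y z : cyc (rpt x y z) = rpt y z x.
Proof. by rewrite /cyc /rpt !c_pt. Qed.

Lemma cycV_rpt x y z : cycV (rpt x y z) = rpt z x y.
Proof. by rewrite /cycV /rpt !c_pt. Qed.

Lemma volume_aut_sheary f : entire f -> volume_aut (sheary f).
Proof.
move=> ef; apply: volume_aut_comp (volume_aut_cyc R).
by apply: volume_aut_comp (volume_aut_cycV R) _; exact: volume_aut_shearx.
Qed.

Lemma volume_aut_shearz f : entire f -> volume_aut (shearz f).
Proof.
move=> ef; apply: volume_aut_comp (volume_aut_cycV R).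
by apply: volume_aut_comp (volume_aut_cyc R) _; exact: volume_aut_shearx.
Qed.

Lemma fibre_timey x y z x' z' : pos_markov x y z -> pos_markov x' y z' ->
  exists t : R, forall f, f y%:C = t%:C -> sheary f (rpt x y z) = rpt x' y z'.
Proof.
move=> /pos_markovC P1 /pos_markovC P2; have [t Ht] := fibre_time P1 P2.
by exists t => f fy; rewrite /sheary /= cyc_rpt (Ht f fy) cycV_rpt.
Qed.

Lemma shearz_time z a b : 0 < 9 * z ^+ 2 - 4 -> 0 < a ->
  a ^+ 2 - (9 * z ^+ 2 - 4) * b ^+ 2 = 1 ->
  exists t : R, forall f, f z%:C = t%:C -> forall x y : R,
    shearz f (rpt x y z) =
    rpt (a * x + b * (2 * y - 3 * z * x)) (a * y + b * (3 * z * y - 2 * x)) z.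
Proof.
move=> D0 a0 E; have [t Ht] := shearx_time D0 a0 E.
by exists t => f fz x y; rewrite /shearz /= cycV_rpt (Ht f fz) cyc_rpt.
Qed.

End PositivePoints.

(** * Separating the coordinates of Markov triples *)

Section Spread.
Variable R : realType.
Implicit Types (n : nat) (u v : R).

(* The parameters of the fibres z = n grow so fast that the intervals
   [spread n, spread_bound n (spread n)] are disjoint. *)
Definition spread_bound n (b : R) : R :=
  n%:R * (1 + 3 * n%:R * b) + 3 * n%:R ^+ 2 * b.

Fixpoint spread n : R :=
  if n is k.+1 then spread k + 1 + spread_bound k (spread k) else 1.

Definition spread_cosh n : R := Num.sqrt (1 + (9 * n%:R ^+ 2 - 4) * spread n ^+ 2).

(** With [lo], the coordinates after a step on the fibre z = n with parameters [spread_cosh n] and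
    [spread n] up to sign. Either of x and y may play [u], so the same estimates separate both
    coordinates. *)
Definition hi n u v := spread_cosh n * u + spread n * (3 * n%:R * u - 2 * v).
Definition lo n u v := spread_cosh n * v - spread n * (3 * n%:R * v - 2 * u).

Lemma spread_gt0 n : 0 < spread n.
Proof.
elim: n => //= n IH; rewrite /spread_bound.
have n0 := ler0n R n; have := mulr_ge0 n0 (ltW IH); have := mulr_ge0 n0 (mulr_ge0 n0 (ltW IH)).
nra.
Qed.

Lemma spread_bound_ge0 n : 0 <= spread_bound n (spread n).
Proof.
have b0 := ltW (spread_gt0 n); have n0 := ler0n R n.
have := mulr_ge0 n0 (mulr_ge0 n0 b0); rewrite /spread_bound; nra.
Qed.

Lemma ler_spread n : n%:R <= spread n.
Proof.
elim: n => //= n IH; rewrite -natr1.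
have := spread_bound_ge0 n; lra.
Qed.

Lemma spread_homo k n : (k <= n)%N -> spread k <= spread n.
Proof.
elim: n => [|n IH]; first by rewrite leqn0 => /eqP ->.
rewrite leq_eqVlt => /predU1P[->//|/IH h]; apply: le_trans h _ => /=.
have := spread_bound_ge0 n; lra.
Qed.

Lemma spread_sep k n : (k < n)%N -> spread_bound k (spread k) < spread n.
Proof.
move=> /spread_homo; apply: lt_le_trans => /=; have := spread_gt0 k; lra.
Qed.

Lemma disc_gt0 n : (0 < n)%N -> 0 < 9 * n%:R ^+ 2 - 4 :> R.
Proof. by move=> n0; have : 1 <= n%:R :> R; [rewrite ler1n|nra]. Qed.

Lemma spread_pell n : (0 < n)%N ->
  spread_cosh n ^+ 2 - (9 * n%:R ^+ 2 - 4) * spread n ^+ 2 = 1.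
Proof.
move=> n0; rewrite sqr_sqrtr ?addrK //.
by rewrite addr_ge0 // mulr_ge0 ?sqr_ge0 // ltW // disc_gt0.
Qed.

Lemma spread_cosh_gt0 n : (0 < n)%N -> 0 < spread_cosh n.
Proof.
by move=> n0; rewrite sqrtr_gt0 ltr_pwDl // mulr_ge0 ?sqr_ge0 // ltW // disc_gt0.
Qed.

Lemma spread_cosh_le n : spread_cosh n <= 1 + 3 * n%:R * spread n.
Proof.
have b0 := ltW (spread_gt0 n); have n0 := ler0n R n; have nb := mulr_ge0 n0 b0.
have h0 : 0 <= 1 + 3 * n%:R * spread n by lra.
rewrite -[leRHS]ger0_norm // -sqrtr_sqr ler_sqrt ?sqr_ge0 //; nra.
Qed.

(** For coordinates between 1 and [n], the factor [3 * n%:R * u - 2 * v] lies between 1 and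
    [3 * n%:R ^+ 2], so the bounds depend on the fibre alone. *)
Lemma hi_bounds n u v : 1 <= u -> u <= n%:R -> 1 <= v -> v <= n%:R ->
  spread n <= hi n u v <= spread_bound n (spread n).
Proof.
move=> u1 un v1 vn; rewrite /hi.
have n1 : 1 <= n%:R :> R by exact: le_trans un.
have n0 : (0 < n)%N by rewrite -(ler1n R).
have b0 := spread_gt0 n; have a0 := spread_cosh_gt0 n0; have ac := spread_cosh_le n.
have h1 : n%:R <= n%:R * u by rewrite ler_peMr // ler0n.
have h2 : n%:R * u <= n%:R * n%:R by rewrite ler_wpM2l.
have k1 : 1 <= 3 * n%:R * u - 2 * v by lra.
have k2 : 3 * n%:R * u - 2 * v <= 3 * n%:R ^+ 2 by rewrite expr2; lra.
have au := mulr_ge0 (ltW a0) (le_trans ler01 u1).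
apply/andP; split.
  have := ler_wpM2l (ltW b0) k1; lra.
rewrite /spread_bound; apply: lerD.
  by rewrite mulrC; apply: ler_pM => //; [lra|exact: ltW].
by rewrite [leRHS]mulrC; exact: ler_wpM2l (ltW b0) _ _ k2.
Qed.

Lemma spread_slope n u v : (0 < n)%N ->
  3 * n%:R * hi n u v - 2 * lo n u v =
  spread_cosh n * (3 * n%:R * u - 2 * v) + spread n * (9 * n%:R ^+ 2 - 4) * u.
Proof. by move=> n0; rewrite /hi /lo; ring. Qed.

(** The final inequality selects the smaller root of the Markov equation, read as a quadratic
    equation for [lo] with [hi] and [n] fixed; thus [hi] determines [lo]. *)
Lemma pos_markov_spread n u v : pos_markov u v n%:R -> 1 <= u -> u <= n%:R ->
  1 <= v -> v <= n%:R ->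
  pos_markov (hi n u v) (lo n u v) n%:R /\ 2 * lo n u v < 3 * n%:R * hi n u v.
Proof.
move=> [u0 v0 n0' E] u1 un v1 vn.
have n0 : (0 < n)%N by rewrite -(ltr0n R).
have /andP[h1 _] := hi_bounds u1 un v1 vn.
have hp : 0 < hi n u v := lt_le_trans (spread_gt0 n) h1.
have Eh : hi n u v ^+ 2 + lo n u v ^+ 2 + n%:R ^+ 2 = 3 * hi n u v * lo n u v * n%:R.
  apply/eqP; rewrite -subr_eq0; apply/eqP.
  transitivity ((spread_cosh n ^+ 2 - (9 * n%:R ^+ 2 - 4) * spread n ^+ 2) *
    (u ^+ 2 + v ^+ 2 - 3 * u * v * n%:R) + n%:R ^+ 2); first by rewrite /hi /lo; ring.
  by rewrite spread_pell // mul1r; move: E; lra.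
split; last first.
  rewrite -subr_gt0 spread_slope // ltr_wpDl //.
    rewrite mulr_ge0 ?ltW ?spread_cosh_gt0 // subr_gt0.
    have : 1 * n%:R <= u * n%:R :> R by rewrite ler_wpM2r // ltW.
    lra.
  by rewrite !mulr_gt0 ?spread_gt0 ?disc_gt0.
split=> //.
have : 0 < (3 * hi n u v * n%:R) * lo n u v.
  have -> : 3 * hi n u v * n%:R * lo n u v = 3 * hi n u v * lo n u v * n%:R by ring.
  by rewrite -Eh ltr_wpDl ?exprn_gt0 // addr_ge0 ?sqr_ge0.
by rewrite pmulr_rgt0 // !mulr_gt0.
Qed.

(** Disjoint intervals recover [n], the choice of the smaller root recovers [lo], and the step with
    the opposite parameter recovers [u] and [v]. *)
Lemma hi_inj n n' u v u' v' :
  pos_markov u v n%:R -> 1 <= u -> u <= n%:R -> 1 <= v -> v <= n%:R ->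
  pos_markov u' v' n'%:R -> 1 <= u' -> u' <= n'%:R -> 1 <= v' -> v' <= n'%:R ->
  hi n u v = hi n' u' v' -> [/\ n = n', u = u' & v = v'].
Proof.
move=> P u1 un v1 vn P' u1' un' v1' vn' Eh.
have /andP[b1 b2] := hi_bounds u1 un v1 vn.
have /andP[b1' b2'] := hi_bounds u1' un' v1' vn'.
have [nn'|n'n|nn'] := ltngtP n n'.
- by have := spread_sep nn'; lra.
- by have := spread_sep n'n; lra.
subst n'; have [Q s] := pos_markov_spread P u1 un v1 vn.
have [Q' s'] := pos_markov_spread P' u1' un' v1' vn'.
have n0 : (0 < n)%N by case: P => _ _; rewrite ltr0n.
have El : lo n u v = lo n u' v'.
  case: Q => _ _ _; case: Q' => _ _ _; rewrite -Eh in s' *; move: s s'.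
  move: (hi n u v) (lo n u v) (lo n u' v') => h l l' s s' e e'.
  have /eqP : (l - l') * (l + l' - 3 * n%:R * h) = 0 by move: e e'; lra.
  rewrite mulf_eq0 => /orP[/eqP|/eqP]; first by lra.
  by move: s s'; lra.
have inv (x y : R) : x = spread_cosh n * hi n x y - spread n * (3 * n%:R * hi n x y - 2 * lo n x y)
    /\ y = spread_cosh n * lo n x y + spread n * (3 * n%:R * lo n x y - 2 * hi n x y).
  split; [transitivity ((spread_cosh n ^+ 2 - (9 * n%:R ^+ 2 - 4) * spread n ^+ 2) * x)
         |transitivity ((spread_cosh n ^+ 2 - (9 * n%:R ^+ 2 - 4) * spread n ^+ 2) * y)];
    try (by rewrite spread_pell // mul1r); rewrite /hi /lo; ring.
have [iu iv] := inv u v; have [iu' iv'] := inv u' v'.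
by split=> //; [rewrite iu iu' Eh El|rewrite iv iv' Eh El].
Qed.

Lemma entire_at_nat (t : nat -> R) :
  exists2 f, entire f & forall n, (0 < n)%N -> f (n%:R)%:C = (t n)%:C.
Proof.
have [|||f ef Hf] := @interpolation R nat (fun n => (n%:R)%:C) (fun n => 0 < n)%N (fun n => (t n)%:C).
- by move=> n n0; rewrite rmorph_nat pnatr_eq0 -lt0n.
- by move=> n m _ _ /complexI /eqP; rewrite eqr_nat => /eqP.
- move=> r; exists (iota 0 (Num.bound `|r|)) => n _; rewrite mem_iota add0n -leqNgt => h.
  have -> : normc ((n%:R)%:C) = n%:R :> R by rewrite normc_real normr_nat.
  apply: le_trans (ler_norm r) _; apply: le_trans (ltW (archi_boundP (normr_ge0 r))) _.
  by rewrite ler_nat.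
by exists f.
Qed.

End Spread.

(** * Ordered Markov triples *)

Section MarkovTriples.
Variable R : realType.
Implicit Types (m : nat * nat * nat).

Definition is_triple m := [&& (0 < m.1.1)%N, (m.1.1 <= m.1.2)%N, (m.1.2 <= m.2)%N &
  (m.1.1 ^ 2 + m.1.2 ^ 2 + m.2 ^ 2 == 3 * m.1.1 * m.1.2 * m.2)%N].

Definition triple_pt m : C3 R := rpt m.1.1%:R m.1.2%:R m.2%:R.

Lemma markov_triplesE (v : C3 R) :
  markov_triples v <-> exists2 m, is_triple m & v = triple_pt m.
Proof.
have E x y z : triple_pt (x, y, z) = pt x%:R y%:R z%:R by rewrite /triple_pt /rpt !rmorph_nat.
split=> [[x [y [z [/and3P[x0 _ _] e /andP[xy yz] ->]]]]|[[[x y] z] /and4P[/= x0 xy yz /eqP e] ->]].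
  by exists (x, y, z); rewrite ?E // /is_triple /= x0 xy yz e /=.
have y0 := leq_trans x0 xy; have z0 := leq_trans y0 yz.
by exists x, y, z; rewrite E x0 y0 z0 xy yz.
Qed.

Lemma is_triple_bounds m : is_triple m ->
  [/\ 1 <= m.1.1%:R :> R, m.1.1%:R <= m.2%:R :> R, 1 <= m.1.2%:R :> R,
      m.1.2%:R <= m.2%:R :> R & pos_markov (m.1.1%:R : R) m.1.2%:R m.2%:R].
Proof.
case: m => [[x y] z] /and4P[/= x0 xy yz /eqP e].
have y0 := leq_trans x0 xy; have z0 := leq_trans y0 yz; have xz := leq_trans xy yz.
rewrite !ler1n !ler_nat x0 y0 xz yz; split=> //; split; rewrite ?ltr0n //.
by rewrite -!natrX -!natrD e !natrM.
Qed.

(** Distinct integers are at distance at least 1. This uniform separation gives discreteness,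
    closedness and injectivity. *)
Lemma triple_pt_ball m m' : ball (triple_pt m) 1 (triple_pt m') -> m = m'.
Proof.
move=> H.
have sep (k k' : nat) : `|((k%:R : R)%:C : Cn R) - ((k'%:R : R)%:C)| < 1 -> k = k'.
  have -> : `|((k%:R : R)%:C : Cn R) - ((k'%:R : R)%:C)| = `|k%:R - k'%:R|%:C.
    by rewrite -normc_real rmorphB.
  have -> : (1 : Cn R) = 1%:C by [].
  rewrite ltcR ltr_norml => /andP[h1 h2].
  have [kk|kk|//] := ltngtP k k'.
    by have q : k.+1%:R <= k'%:R :> R; [rewrite ler_nat|exfalso; move: q {kk}; rewrite -natr1; lra].
  by have q : k'.+1%:R <= k%:R :> R; [rewrite ler_nat|exfalso; move: q {kk}; rewrite -natr1; lra].
have coord j : `|(triple_pt m : 'rV[R[i]]_3) ord0 j - (triple_pt m' : 'rV[R[i]]_3) ord0 j : Cn R| < 1.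
  by case: H => _ /(_ ord0 j); rewrite -ball_normE.
have := coord i0; have := coord i1; have := coord i2; rewrite !mxE /=.
by case: m m' {H coord} => [[x y] z] [[x' y'] z'] /= /sep -> /sep -> /sep ->.
Qed.

Lemma triple_pt_inj : injective triple_pt.
Proof. by move=> m m' E; apply: triple_pt_ball; rewrite E; exact: ballxx. Qed.

Lemma markov_triples_reg : markov_triples (R := R) `<=` Mreg (R := R).
Proof.
move=> v /markov_triplesE[m tm ->]; have [x1 xz y1 yz [x0 y0 z0 E]] := is_triple_bounds tm.
have toC (r : R) : r = 0 -> r%:C = 0 by move=> ->.
split.
  rewrite /M /= /markovP /triple_pt /rpt !c_pt.
  have E3 : 3 = 3%:C :> R[i] by rewrite -(rmorph_nat (real_complex R)).
  rewrite E3 -!rmorphXn -!rmorphM -!rmorphD -rmorphB /=; apply: toC; lra.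
move=> [+ [_ _]].
have E3 : 3 = 3%:C :> R[i] by rewrite -(rmorph_nat (real_complex R)).
have E2 : 2 = 2%:C :> R[i] by rewrite -(rmorph_nat (real_complex R)).
rewrite /Px /triple_pt /rpt !c_pt E3 E2 -!rmorphM -rmorphB => /complexI.
have : m.1.1%:R * 1 <= m.2%:R * m.1.2%:R :> R by apply: ler_pM; rewrite // ltW.
have : 0 < m.1.1%:R :> R by []. lra.
Qed.

Lemma markov_triples_closed_discrete : closed_discrete (markov_triples (R := R)).
Proof.
have half0 : (0 : Cn R) < 1 / 2 by rewrite divr_gt0.
split; last first.
  move=> _ /markov_triplesE[m _ ->]; exists ((ball (triple_pt m) 1)°).
  split; [exact: open_interior|exact: nbhsx_ballx|].
  by move=> b /interior_subset bb /markov_triplesE[m' _ E]; rewrite E in bb *; rewrite (triple_pt_ball bb).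
move=> p cp.
(* Two triples within 1/2 of [p] coincide. If [p] were not the first one found, removing that one
   from the neighbourhood would produce a different second one. *)
have [_ [/markov_triplesE[m tm ->] bm]] := cp _ (nbhsx_ballx p _ half0).
have [->|/eqP pm] := pselect (p = triple_pt m); first by apply/markov_triplesE; exists m.
have op : nbhs p (~` [set triple_pt m]).
  apply: open_nbhs_nbhs; split; last exact/eqP.
  rewrite openC; apply: accessible_closed_set1; apply: hausdorff_accessible.
  exact: norm_hausdorff.
have [_ [/markov_triplesE[m' tm' ->] [bm' /= ne]]] := cp _ (filterI (nbhsx_ballx p _ half0) op).
by exfalso; apply: ne; rewrite (triple_pt_ball (ball_splitr bm bm')).
Qed.

(** The branch (1, 1, 1), (1, 1, 2), (1, 2, 5), (1, 5, 13), ... of the Markov tree, with odd-indexed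
    Fibonacci numbers, obtained by Vieta jumping. The subtraction is not truncated, as the pairs are
    increasing. *)
Fixpoint fib_pair n : nat * nat :=
  if n is k.+1 then ((fib_pair k).2, 3 * (fib_pair k).2 - (fib_pair k).1)%N else (1, 1)%N.

Lemma fib_pairP n : is_triple (1%N, (fib_pair n).1, (fib_pair n).2).
Proof.
elim: n => [|n] //; rewrite /is_triple /=; case: (fib_pair n) => y z /= /and3P[y1 yz /eqP e].
apply/and3P; split; [lia|lia|apply/eqP].
have [w Hw] : exists w, (3 * z - y = w /\ 3 * z = w + y)%N by exists (3 * z - y)%N; lia.
case: Hw => -> Hw; nia.
Qed.

Lemma fib_pair_lt k n : (k < n)%N -> ((fib_pair k).2 < (fib_pair n).2)%N.
Proof.
elim: n => // n IH; rewrite ltnS leq_eqVlt => /orP H.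
have st : ((fib_pair n).2 < (fib_pair n.+1).2)%N.
  have := fib_pairP n; rewrite /is_triple /=; case: (fib_pair n) => y z /= /and3P[y1 yz _]; lia.
by case: H => [/eqP ->//|/IH h]; exact: ltn_trans h st.
Qed.

Lemma markov_triples_infinite : infinite_set (markov_triples (R := R)).
Proof.
pose s n := triple_pt (1%N, (fib_pair n).1, (fib_pair n).2).
have sinj : injective s.
  move=> k n /triple_pt_inj [_ E].
  by have [/fib_pair_lt|/fib_pair_lt|//] := ltngtP k n; rewrite E ltnn.
move=> fA; apply: infinite_nat.
have -> : [set: nat] = s @^-1` (markov_triples (R := R)).
  apply/seteqP; split=> // n _; apply/markov_triplesE.
  by exists (1%N, (fib_pair n).1, (fib_pair n).2) => //; exact: fib_pairP.
by apply: finite_preimage => // ? ? _ _; exact: sinj.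
Qed.

End MarkovTriples.

(** * Assembling the interpolating automorphism *)

Section Tameness.
Variable R : realType.
Implicit Types (m : nat * nat * nat).

(** Only finitely many triples have last entry below a given [N], since the other entries are no
    larger; as [X m] is at least the last entry, the nodes are discrete. *)
Lemma entire_at_triples (P : pred (nat * nat * nat)) (X t : nat * nat * nat -> R) :
  (forall m, P m -> is_triple m) -> (forall m, P m -> m.2%:R <= X m) ->
  (forall m m', P m -> P m' -> X m = X m' -> m = m') ->
  exists2 f, entire f & forall m, P m -> f (X m)%:C = (t m)%:C.
Proof.
move=> Ptr Xm Xinj.
have X0 m : P m -> 0 < X m.
  move=> Pm; apply: lt_le_trans (Xm _ Pm).
  by have [_ _ _ _ []] := is_triple_bounds R (Ptr _ Pm).
have [|||f ef Hf] := @interpolation R _ (fun m => (X m)%:C) P (fun m => (t m)%:C).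
- by move=> m Pm; apply/eqP => /complexI E; have := X0 _ Pm; rewrite E ltxx.
- by move=> m m' Pm Pm' /complexI; exact: Xinj.
- move=> r; have [N HN] : exists N, `|r| <= N%:R :> R.
    by exists (Num.bound `|r|); exact: ltW (archi_boundP (normr_ge0 r)).
  exists [seq (xy, z) | xy <- [seq (x, y) | x <- iota 0 N, y <- iota 0 N], z <- iota 0 N] => m Pm ml.
  have -> : normc (X m)%:C = X m by rewrite normc_real gtr0_norm // X0.
  apply: le_trans (Xm _ Pm); apply: le_trans (ler_norm r) _.
  apply: le_trans HN _; rewrite ler_nat.
  rewrite leqNgt; apply/negP => mN; move/negP: ml; apply.
  have /and4P[x0 xy yz _] := Ptr _ Pm.
  case: m x0 xy yz mN {Pm} => [[x y] z] /= x0 xy yz zN.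
  have yN := leq_ltn_trans yz zN; have xN := leq_ltn_trans xy yN.
  apply: (allpairs_f (fun xy z => (xy, z))); last by rewrite mem_iota.
  by apply: (allpairs_f pair); rewrite mem_iota.
by exists f.
Qed.

Lemma spread_x : exists (Psi : C3 R -> C3 R) (X Y : nat * nat * nat -> R),
  [/\ volume_aut Psi,
   forall m, is_triple m -> Psi (triple_pt R m) = rpt (X m) (Y m) m.2%:R,
   forall m, is_triple m -> pos_markov (X m) (Y m) m.2%:R,
   forall m, is_triple m -> m.2%:R <= X m &
   forall m m', is_triple m -> is_triple m' -> X m = X m' -> m = m'].
Proof.
(* The time depends only on the fibre z = n, so one entire function serves all triples. At [n = 0],
   where no triple lies, the time is a default. *)
have /choice[t Ht] : forall n, exists t : R, (0 < n)%N -> forall f,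
    f (n%:R)%:C = t%:C -> forall x y : R,
    shearz f (rpt x y n%:R) = rpt (hi n x y) (lo n x y) n%:R.
  move=> n; case: (posnP n) => [->|n0]; first by exists 0.
  have [|t Ht] := @shearz_time R n%:R (spread_cosh R n) (- spread R n)
     (disc_gt0 R n0) (spread_cosh_gt0 R n0).
    by rewrite sqrrN spread_pell.
  by exists t => _ f fn x y; rewrite (Ht f fn) /hi /lo; congr rpt; ring.
have [f ef Hf] := entire_at_nat t.
exists (shearz f), (fun m => hi m.2 m.1.1%:R m.1.2%:R), (fun m => lo m.2 m.1.1%:R m.1.2%:R).
split.
- exact: volume_aut_shearz.
- move=> m tm; have [_ _ _ _ [_ _ z0 _]] := is_triple_bounds R tm; rewrite ltr0n in z0.
  by rewrite /triple_pt (Ht _ z0 f (Hf _ z0)).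
- move=> m tm; have [x1 xz y1 yz P] := is_triple_bounds R tm.
  by have [] := pos_markov_spread P x1 xz y1 yz.
- move=> m tm; have [x1 xz y1 yz _] := is_triple_bounds R tm.
  have /andP[h _] := hi_bounds x1 xz y1 yz; exact: le_trans (ler_spread _ _) h.
- move=> m m' tm tm' E; have [x1 xz y1 yz P] := is_triple_bounds R tm.
  have [x1' xz' y1' yz' P'] := is_triple_bounds R tm'.
  have [ez /eqP ex /eqP ey] := hi_inj P x1 xz y1 yz P' x1' xz' y1' yz' E.
  by move: ex ey ez; rewrite !eqr_nat; case: (m) (m') => [[? ?] ?] [[? ?] ?] /= /eqP -> /eqP -> ->.
Qed.

Lemma pos_markov_swap (x y z : R) : pos_markov x y z -> pos_markov y x z.
Proof. by move=> [x0 y0 z0 E]; split=> //; move: E; lra. Qed.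

(** Reversing the sign of the [spread] parameter exchanges the roles of the first two
    coordinates. *)
Lemma spread_y : exists (Psi : C3 R -> C3 R) (X Y : nat * nat * nat -> R),
  [/\ volume_aut Psi,
   forall m, is_triple m -> Psi (triple_pt R m) = rpt (X m) (Y m) m.2%:R,
   forall m, is_triple m -> pos_markov (X m) (Y m) m.2%:R,
   forall m, is_triple m -> m.2%:R <= Y m &
   forall m m', is_triple m -> is_triple m' -> Y m = Y m' -> m = m'].
Proof.
have /choice[t Ht] : forall n, exists t : R, (0 < n)%N -> forall f,
    f (n%:R)%:C = t%:C -> forall x y : R,
    shearz f (rpt x y n%:R) = rpt (lo n y x) (hi n y x) n%:R.
  move=> n; case: (posnP n) => [->|n0]; first by exists 0.
  have [|t Ht] := @shearz_time R n%:R (spread_cosh R n) (spread R n)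
     (disc_gt0 R n0) (spread_cosh_gt0 R n0).
    by rewrite spread_pell.
  by exists t => _ f fn x y; rewrite (Ht f fn) /hi /lo; congr rpt; ring.
have [f ef Hf] := entire_at_nat t.
exists (shearz f), (fun m => lo m.2 m.1.2%:R m.1.1%:R), (fun m => hi m.2 m.1.2%:R m.1.1%:R).
split.
- exact: volume_aut_shearz.
- move=> m tm; have [_ _ _ _ [_ _ z0 _]] := is_triple_bounds R tm; rewrite ltr0n in z0.
  by rewrite /triple_pt (Ht _ z0 f (Hf _ z0)).
- move=> m tm; have [x1 xz y1 yz /pos_markov_swap P] := is_triple_bounds R tm.
  by have [/pos_markov_swap] := pos_markov_spread P y1 yz x1 xz.
- move=> m tm; have [x1 xz y1 yz _] := is_triple_bounds R tm.
  have /andP[h _] := hi_bounds y1 yz x1 xz; exact: le_trans (ler_spread _ _) h.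
- move=> m m' tm tm' E; have [x1 xz y1 yz /pos_markov_swap P] := is_triple_bounds R tm.
  have [x1' xz' y1' yz' /pos_markov_swap P'] := is_triple_bounds R tm'.
  have [ez /eqP ey /eqP ex] := hi_inj P y1 yz x1 xz P' y1' yz' x1' xz' E.
  by move: ex ey ez; rewrite !eqr_nat; case: (m) (m') => [[? ?] ?] [[? ?] ?] /= /eqP -> /eqP -> ->.
Qed.

(** The larger root of the equation in [z]; its discriminant is nonnegative because [x] and [y] are
    at least 1. *)
Lemma pos_markov_root (x y : R) : 1 <= x -> 1 <= y -> exists z, pos_markov x y z.
Proof.
move=> x1 y1; pose d := 9 * x ^+ 2 * y ^+ 2 - 4 * x ^+ 2 - 4 * y ^+ 2.
have x2 : 1 <= x ^+ 2 by rewrite exprn_ege1.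
have y2 : 1 <= y ^+ 2 by rewrite exprn_ege1.
have d0 : 0 <= d by rewrite /d; nra.
have x0 : 0 < x by lra.
have y0 : 0 < y by lra.
exists ((3 * x * y + Num.sqrt d) / 2); split=> //.
  by rewrite divr_gt0 // ltr_pwDl ?sqrtr_ge0 // !mulr_gt0.
have := sqr_sqrtr d0; move: (Num.sqrt d) => s; rewrite /d => Es.
apply/eqP; rewrite -subr_eq0; apply/eqP.
transitivity ((s ^+ 2 - (9 * x ^+ 2 * y ^+ 2 - 4 * x ^+ 2 - 4 * y ^+ 2)) / 4); first by field.
by rewrite Es subrr mul0r.
Qed.

Lemma volume_aut_interpolates (j : nat * nat * nat -> nat * nat * nat) :
  (forall m, is_triple m -> is_triple (j m)) ->
  (forall m m', is_triple m -> is_triple m' -> j m = j m' -> m = m') ->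
  exists2 F : C3 R -> C3 R, volume_aut F &
    forall m, is_triple m -> F (triple_pt R m) = triple_pt R (j m).
Proof.
move=> jt jinj.
have [Psi [X [Y1 [vPsi EPsi PX Xz Xinj]]]] := spread_x.
have [Psi' [X2 [Y [vPsi' EPsi' PY Yz Yinj]]]] := spread_y.
have ge1 (r : R) m : is_triple m -> m.2%:R <= r -> 1 <= r.
  by move=> /(is_triple_bounds R)[x1 xz _ _ _] h; apply: le_trans x1 (le_trans xz h).
(* [zeta m] completes the meeting point, which shares its x with the image of [m] under [Psi] and
   its y with that of [j m] under [Psi']. *)
have /choice[zeta Hzeta] : forall m, exists z : R, is_triple m -> pos_markov (X m) (Y (j m)) z.
  move=> m; case: (boolP (is_triple m)) => tm; last by exists 0.
  have [z Hz] := pos_markov_root (ge1 _ _ tm (Xz _ tm)) (ge1 _ _ (jt _ tm) (Yz _ (jt _ tm))).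
  by exists z.
have /choice[tx Htx] : forall m, exists t : R, is_triple m -> forall f, f (X m)%:C = t%:C ->
    shearx f (rpt (X m) (Y1 m) m.2%:R) = rpt (X m) (Y (j m)) (zeta m).
  move=> m; case: (boolP (is_triple m)) => tm; last by exists 0.
  by have [t Ht] := fibre_time (PX _ tm) (Hzeta _ tm); exists t.
(* This time is attached to the node of [m'], but its target involves the preimage of [m'] under
   [j]: injectivity makes that unique, and off the image the time is 0. *)
have /choice[ty Hty] : forall m', exists t : R, forall m, is_triple m -> j m = m' ->
    forall f, f (Y m')%:C = t%:C ->
    sheary f (rpt (X2 m') (Y m') m'.2%:R) = rpt (X m) (Y m') (zeta m).
  move=> m'; have [[m [tm E]]|no] := pselect (exists m, is_triple m /\ j m = m'); last first.
    by exists 0 => m tm E; exfalso; apply: no; exists m.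
  have P1 := PY _ (jt _ tm); have [t Ht] := fibre_timey P1 (Hzeta _ tm).
  exists t => m1 tm1 E1; have -> : m1 = m by apply: jinj => //; rewrite E1.
  by rewrite -E.
have [f ef Hf] := @entire_at_triples is_triple X tx (fun _ h => h) Xz Xinj.
have [g eg Hg] := @entire_at_triples is_triple Y ty (fun _ h => h) Yz Yinj.
have [T [vT TK _]] := volume_aut_inv (volume_aut_sheary eg).
have [S [vS SK _]] := volume_aut_inv vPsi'.
exists (S \o T \o shearx f \o Psi).
  apply: volume_aut_comp vPsi; apply: volume_aut_comp (volume_aut_shearx ef).
  exact: volume_aut_comp vS vT.
move=> m tm; rewrite /= (EPsi _ tm) (Htx _ tm f (Hf _ tm)).
have tj := jt _ tm.
(* The meeting point is rewritten as the y-sheared image of [j m], which [T] and [S] then undo. *)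
by rewrite -(Hty _ _ tm erefl g (Hg _ tj)) TK -(EPsi' _ tj) SK.
Qed.

End Tameness.

Theorem theorem1p6 (R : realType) :
  tame (@symp_aut R) (@markov_triples R).
Proof.
split.
- exact: markov_triples_reg.
- exact: markov_triples_infinite.
- exact: markov_triples_closed_discrete.
move=> iota iA iinj.
(* The injection is recoded on triples of naturals, with [m] itself as default where [m] is not a
   Markov triple. *)
have /choice[j Hj] : forall m, exists m', is_triple m ->
    is_triple m' /\ iota (triple_pt R m) = triple_pt R m'.
  move=> m; case: (boolP (is_triple m)) => tm; last by exists m.
  have /markov_triplesE[m' tm' E] := iA _ ((markov_triplesE _).2 (ex_intro2 _ _ m tm erefl)).
  by exists m'.
have [||F vF HF] := @volume_aut_interpolates R j.
- by move=> m tm; have [] := Hj _ tm.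
- move=> m m' tm tm' E; apply: (@triple_pt_inj R); apply: iinj.
  + by apply/markov_triplesE; exists m.
  + by apply/markov_triplesE; exists m'.
  + by rewrite (Hj _ tm).2 (Hj _ tm').2 E.
exists F; split; first exact: volume_aut_symp.
by move=> _ /markov_triplesE[m tm ->]; rewrite (HF _ tm) (Hj _ tm).2.
Qed.
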